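(* Let $1\le k\le n$, let $f=f(t,x,q)$ be a smooth integrand, and let $g=(g^\alpha_i(t,x))$ be a smooth slope field such that $\hat f(t,x):=f(t,x,g(t,x))$ is nowhere zero. Suppose that the distribution of $n$-planes $\partial x^\alpha/\partial t^i=g^\alpha_i(t,x)$ in the $(t,x)$-space is integrable, and that the manifold $\mathfrak M=\{(t,x,q): q^\alpha_i=g^\alpha_i(t,x)\}$ is $k$-Lagrangian, i.e. the restriction to $\mathfrak M$ of the $n$-form $\Delta$ (defined in the context) is closed. Then the $n$-dimensional leaves of the foliation of the $(t,x)$-space defined by the distribution, written as graphs $x=x(t)$, are solutions of the Euler equations $$\sum_{i=1}^n\frac{d}{dt^i}\Big(f_{q^\alpha_i}\big(t,x(t),\tfrac{Dx}{Dt}(t)\big)\Big)-f_{x^\alpha}\big(t,x(t),\tfrac{Dx}{Dt}(t)\big)=0,\qquad \alpha=1,\dots,\nu .$$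
   Context: Setting: $\xi$ is a $\nu$-dimensional vector bundle over a domain $\mathfrak N$ of an $n$-dimensional manifold; one works in a chart with coordinates $t=(t^1,\dots,t^n)$ on the base and $x=(x^1,\dots,x^\nu)$ on the fibers. Points of the bundle $J_1(\xi)$ of 1-jets have coordinates $(t,x,q)$, $q=(q^\alpha_i)$, where $q^\alpha_i$ stands for $\partial x^\alpha/\partial t^i$. Latin indices run over $1,\dots,n$, Greek indices over $1,\dots,\nu$. The functional is $\mathcal F(x)=\int f(t,x,\frac{Dx}{Dt})\,dt^1\wedge\dots\wedge dt^n$, where $\frac{Dx}{Dt}=(\partial x^\alpha/\partial t^i)$. Subscripts $f_{q^\alpha_i}, f_{x^\alpha}$ denote partial derivatives with respect to the independent variables $(t,x,q)$. A slope field is a section $q^\alpha_i=g^\alpha_i(t,x)$ of $J_1(\xi)\to\xi$; it defines the distribution of $n$-planes that is the common kernel of the 1-forms $\omega^\alpha=dx^\alpha-\sum_{j=1}^n g^\alpha_j(t,x)\,dt^j$. Its image $\mathfrak M\subset J_1(\xi)$ has dimension $\nu+n$ and projects diffeomorphically onto $\xi$. Let $I=\{1,\dots,n\}$. For $K=\{i_1<\dots<i_k\}\subset I$ put $r(K)=\sum_{i\in K}i-\frac{k(k+1)}2$, so that $dt^{i_1}\wedge\dots\wedge dt^{i_k}\wedge dt^{I\setminus K}=(-1)^{r(K)}dt^1\wedge\dots\wedge dt^n$, where $dt^{I\setminus K}$ is the exterior product of the remaining $dt^j$ in increasing order. Put $\hat p^i_\alpha(t,x)=f_{q^\alpha_i}(t,x,g(t,x))$.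 The restriction to $\mathfrak M$ of the form $\Delta$, expressed in the coordinates $(t,x)$, is $$\Delta=\sum_{|K|=k}\frac{(-1)^{r(K)}}{\binom nk \hat f^{\,k-1}}\Big(\prod_{i\in K}\Big[\hat f\,dt^i+\frac nk\sum_{\alpha=1}^\nu \hat p^i_\alpha\,\omega^\alpha\Big]\Big)\wedge dt^{I\setminus K},$$ where $\prod$ is the exterior product taken in increasing order of $i$. *)

(* Defs.v *)
(* MathComp / MathComp-Analysis *)
From HB Require Import structures.
From mathcomp Require Import all_boot all_order all_algebra.
From mathcomp Require Import all_classical all_reals all_analysis.

Set Implicit Arguments.
Unset Strict Implicit.
Unset Printing Implicit Defensive.
Import Order.TTheory GRing.Theory Num.Theory.
Import numFieldNormedType.Exports.
Local Open Scope classical_set_scope.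
Local Open Scope ring_scope.

(* C^k in the Frechet sense.  The spaces used below are finite-dimensional, so
   "p |-> Df(p) is C^(k-1)" is expressed by all the maps p |-> Df(p) v.
   Meant for open O only. *)
Fixpoint Ck_on (R : realType) (V W : normedModType R) (k : nat) (O : set V)
    (f : V -> W) : Prop :=
  match k with
  | 0 => forall p, O p -> {for p, continuous f}
  | k'.+1 => (forall p, O p -> differentiable f p) /\
             (forall v : V, Ck_on k' O ('D_v f))
  end.

Definition smooth_on (R : realType) (V W : normedModType R) (O : set V)
    (f : V -> W) : Prop := forall k, Ck_on k O f.

(* The exterior algebra of the dual of R^N: the value at S = {s_1 < ... < s_m}
   is the coefficient of dz^(s_1) /\ ... /\ dz^(s_m). *)
Definition ext (R : realType) (N : nat) := {ffun {set 'I_N} -> R^o}.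

(* The sign of the shuffle that sorts the elements of S followed by those
   of T. *)
Definition shuffle_sign (R : realType) (N : nat) (S T : {set 'I_N}) : R :=
  (-1) ^+ #|[set ij : 'I_N * 'I_N | [&& ij.1 \in S, ij.2 \in T & ij.2 < ij.1]%N]%SET|.

Definition wedge (R : realType) (N : nat) (u v : ext R N) : ext R N :=
  [ffun U : {set 'I_N} => \sum_(S : {set 'I_N} | S \subset U)
     shuffle_sign R S (U :\: S) * u S * v (U :\: S)].

Definition ext_one (R : realType) (N : nat) : ext R N :=
  [ffun S : {set 'I_N} => (S == finset.set0)%:R].

Definition dz (R : realType) (N : nat) (i : 'I_N) : ext R N :=
  [ffun S : {set 'I_N} => (S == [set i]%SET)%:R].

(* The exterior product over K of the 1-covectors w i, in increasing order of i
   (enum K is increasing). *)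
Definition wedge_over (R : realType) (N n : nat) (K : {set 'I_n})
    (w : 'I_n -> ext R N) : ext R N :=
  \big[@wedge R N/ext_one R N]_(i <- enum K) w i.

Definition ev1 (R : realType) (N : nat) (w : ext R N) (v : 'rV[R]_N) : R :=
  \sum_(i < N) w [set i]%SET * v 0 i.

Definition extd (R : realType) (N : nat) (eta : 'rV[R]_N -> ext R N)
    (p : 'rV[R]_N) : ext R N :=
  \sum_(i < N) wedge (dz R i)
    [ffun S : {set 'I_N} => 'D_(delta_mx 0 i) (fun z => eta z S : R) p].

Definition closed_form_on (R : realType) (N : nat) (O : set 'rV[R]_N)
    (eta : 'rV[R]_N -> ext R N) : Prop :=
  forall p, O p -> extd eta p = 0.

(* Coordinates: a point (t, x) is row_mx t x : 'rV_(n + nu), so that dt^i and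
   dx^al are the dz of lshift nu i and rshift n al; the fibre coordinates of a
   1-jet form the matrix q with q al i = q^al_i. *)
Definition jet_space (R : realType) (n nu : nat) :=
  ('rV[R]_(n + nu) * 'M[R]_(nu, n))%type.

Section SlopeField.
Variables (R : realType) (n nu : nat).
Implicit Types (f : jet_space R n nu -> R) (g : 'rV[R]_(n + nu) -> 'M[R]_(nu, n)).

Definition dt (i : 'I_n) : ext R (n + nu) := dz R (lshift nu i).
Definition dx (al : 'I_nu) : ext R (n + nu) := dz R (rshift n al).

Definition f_q f (al : 'I_nu) (i : 'I_n) : jet_space R n nu -> R :=
  'D_((0, delta_mx al i) : jet_space R n nu) f.
Definition f_x f (al : 'I_nu) : jet_space R n nu -> R :=
  'D_((delta_mx 0 (rshift n al), 0) : jet_space R n nu) f.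

Definition omega g (al : 'I_nu) (p : 'rV[R]_(n + nu)) : ext R (n + nu) :=
  dx al - \sum_(j < n) g p al j *: dt j.

Definition slope_distribution g (p : 'rV[R]_(n + nu)) : set 'rV[R]_(n + nu) :=
  [set v | forall al, ev1 (omega g al p) v = 0].

(* phi parametrizes over W an (immersed, n-dimensional) integral manifold of
   the distribution; the equality of n-planes makes phi an immersion. *)
Definition integral_manifold (Om : set 'rV[R]_(n + nu)) g
    (W : set 'rV[R]_n) (phi : 'rV[R]_n -> 'rV[R]_(n + nu)) : Prop :=
  [/\ open W, smooth_on W phi &
      forall s, W s -> Om (phi s) /\ range ('d phi s) = slope_distribution g (phi s)].

Definition integrable_distribution (Om : set 'rV[R]_(n + nu)) g : Prop :=
  forall p, Om p -> exists W phi s,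
    [/\ integral_manifold Om g W phi, W s & phi s = p].

Definition leaf_graph (Om : set 'rV[R]_(n + nu)) g
    (V : set 'rV[R]_n) (x : 'rV[R]_n -> 'rV[R]_nu) : Prop :=
  integral_manifold Om g V (fun t => row_mx t (x t)).

Definition fhat f g (p : 'rV[R]_(n + nu)) : R := f (p, g p).
Definition phat f g (i : 'I_n) (al : 'I_nu) (p : 'rV[R]_(n + nu)) : R :=
  f_q f al i (p, g p).

(* 'I_n starts at 0, whence i.+1; the subtraction never truncates. *)
Definition rsign (K : {set 'I_n}) : nat :=
  (\sum_(i in K) i.+1 - (#|K| * #|K|.+1)./2)%N.

Definition Delta (k : nat) f g (p : 'rV[R]_(n + nu)) : ext R (n + nu) :=
  \sum_(K : {set 'I_n} | #|K| == k)
    ((-1) ^+ rsign K / ('C(n, k)%:R * fhat f g p ^+ k.-1)) *: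
    wedge
      (wedge_over K (fun i => fhat f g p *: dt i +
         (n%:R / k%:R) *: \sum_(al < nu) phat f g i al p *: omega g al p))
      (wedge_over (~: K)%SET dt).

(* The graph manifold {q = g(t, x)} is parametrized by (t, x); Delta above is
   already written in these coordinates. *)
Definition k_lagrangian (k : nat) (Om : set 'rV[R]_(n + nu)) f g : Prop :=
  closed_form_on Om (Delta k f g).

Definition jet1 (x : 'rV[R]_n -> 'rV[R]_nu) (t : 'rV[R]_n) : jet_space R n nu :=
  (row_mx t (x t), \matrix_(al, i) 'D_(delta_mx 0 i) (fun s => x s 0 al) t).

Definition euler_equations f (V : set 'rV[R]_n) (x : 'rV[R]_n -> 'rV[R]_nu) :
    Prop :=
  forall t, V t -> forall al,
    \sum_(i < n) 'D_(delta_mx 0 i) (fun s => f_q f al i (jet1 x s)) t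
      - f_x f al (jet1 x t) = 0.

End SlopeField.

(* Main.v *)
(* At a point p of the leaf take the leaf directions
   v_j = d/dt^j + sum_al g^al_j(p) d/dx^al and evaluate d Delta = 0 on
   (d/dx^be, v_1, ..., v_n), all extended as constant vector fields.  This gives
   an alternating sum of directional derivatives of evaluations of Delta, and
   each evaluation of an n-fold product of 1-forms is a determinant.  Dividing
   its i-th row by fhat for i in K leaves det(1 + X) or, when d/dx^be is among
   the arguments, a combination of entries of adj(1 + X), where X(p) = 0.  So
   only  D det(1 + X) = tr DX  and  D adj(1 + X) = (tr DX) 1 - DX  are needed,
   and averaging over K turns the identity into
     D_be fhat - sum_(i, al) p^i_al D_be g^al_i = sum_j D_(v_j) p^j_be
   plus terms quadratic in p.  These cancel because D_(v_j) g^al_l is symmetric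
   in j and l: on the leaf, g^al_l is the partial derivative of x^al. *)

Require Import Defs.
From HB Require Import structures.
From mathcomp Require Import all_boot all_order all_algebra perm.
From mathcomp Require Import reals ring lra zify.

Set Implicit Arguments.
Unset Strict Implicit.
Unset Printing Implicit Defensive.
Import Order.TTheory GRing.Theory Num.Theory.
Local Open Scope ring_scope.

(** * Exterior algebra *)

Section Exterior.
Variables (R : realType) (N : nat).
Implicit Types (S T U : {set 'I_N}) (u w : ext R N) (v : 'rV[R]_N).

Lemma shuffle_signUl S S' T : [disjoint S & S'] ->
  shuffle_sign R (S :|: S') T = shuffle_sign R S T * shuffle_sign R S' T.
Proof.
move=> dSS'; rewrite /shuffle_sign -exprD; congr (_ ^+ _).
rewrite -cardsUI [X in (_ + X)%N](_ : _ = 0%N) ?addn0.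
  by apply: eq_card => -[i j]; rewrite !inE /= andb_orl.
apply/eqP; rewrite cards_eq0; apply/eqP/setP => -[i j]; rewrite !inE /=.
case: (boolP (i \in S)) => //= /(disjointFr dSS') ->.
by rewrite andbF.
Qed.

Lemma shuffle_signUr S T T' : [disjoint T & T'] ->
  shuffle_sign R S (T :|: T') = shuffle_sign R S T * shuffle_sign R S T'.
Proof.
move=> dTT'; rewrite /shuffle_sign -exprD; congr (_ ^+ _).
rewrite -cardsUI [X in (_ + X)%N](_ : _ = 0%N) ?addn0.
  by apply: eq_card => -[i j]; rewrite !inE /= andb_orl andb_orr.
apply/eqP; rewrite cards_eq0; apply/eqP/setP => -[i j]; rewrite !inE /=.
case: (boolP (j \in T)) => //= [/(disjointFr dTT') -> |]; by rewrite !andbF.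
Qed.

Lemma shuffle_sign0l T : shuffle_sign R set0 T = 1.
Proof.
rewrite /shuffle_sign (_ : [set _ | _] = set0) ?cards0 ?expr0//.
by apply/setP => -[i j]; rewrite !inE.
Qed.

Lemma shuffle_sign_sqr S T : shuffle_sign R S T ^+ 2 = 1.
Proof. exact: sqrr_sign. Qed.

Lemma shuffle_sign1 (i j : 'I_N) :
  shuffle_sign R [set i] [set j] = (-1) ^+ (j < i)%N.
Proof.
rewrite /shuffle_sign; congr (_ ^+ _); case: ltnP => ji.
  rewrite -[RHS](cards1 (i, j)); apply: eq_card => -[a b]; rewrite !inE /= xpair_eqE.
  by case: eqP => //= ->; case: eqP => //= ->.
apply/eqP; rewrite cards_eq0; apply/eqP/setP => -[a b]; rewrite !inE /=.
by case: eqP => //= ->; case: eqP => //= ->; rewrite ltnNge ji.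
Qed.

Lemma shuffle_sign1C (i j : 'I_N) : i != j ->
  shuffle_sign R [set i] [set j] = - shuffle_sign R [set j] [set i].
Proof.
move=> ij; rewrite !shuffle_sign1; case: ltngtP => [_|_|/val_inj e].
1,2: by rewrite ?expr0 ?expr1 ?opprK.
by rewrite e eqxx in ij.
Qed.

(** Both sides are sums over chains S, V, U of nested index sets, with V the union of the indices of
    the first two factors. The signs agree because inversion counts add over disjoint unions in
    either argument. *)
Lemma wedgeA u1 u2 u3 : wedge u1 (wedge u2 u3) = wedge (wedge u1 u2) u3.
Proof.
apply/ffunP => U; rewrite !ffunE.
under [RHS]eq_bigr => V _ do rewrite ffunE mulr_sumr mulr_suml.
rewrite [RHS](exchange_big_dep (fun S => S \subset U)) /=; last first.
  by move=> V S VU SV; apply: subset_trans SV VU.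
apply: eq_bigr => S SU; rewrite ffunE mulr_sumr.
(* The inner sum on the left runs over subsets of [U :\: S]; writing them as [V :\: S] brings it to
   the chain form of the right side. *)
rewrite (reindex_onto (fun V => V :\: S) (fun T => S :|: T)) /=; last first.
  move=> T TUS; rewrite setDUl setDv set0U; apply/setDidPl.
  by move: TUS; rewrite subsetD => /andP[].
apply: eq_big => [V|V /andP[VUS /eqP SV]].
  apply/andP/andP => -[].
    rewrite subsetD => /andP[VSU _] /eqP <-; split; last exact: subsetUl.
    by rewrite subUset SU.
  move=> VU SV; split; first exact: setSD.
  by apply/eqP; rewrite setUC; apply/setP => i; rewrite !inE;
     case: (boolP (i \in S)) => [/(subsetP SV)->|]; rewrite ?orbT ?orbF.
have dVS : [disjoint S & V :\: S].
  by rewrite disjoint_sym; move: (subsetDr V S); rewrite disjoints_subset.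
have sSV : S \subset V by rewrite -SV subsetUl.
have VU : V \subset U by rewrite -SV subUset SU (subset_trans VUS (subsetDl _ _)).
have eU : (U :\: S) :\: (V :\: S) = U :\: V.
  apply/setP => i; rewrite !inE; case: (boolP (i \in S)) => //= iS.
  by rewrite (subsetP sSV).
have eU' : U :\: S = (V :\: S) :|: (U :\: V).
  apply/setP => i; rewrite !inE; case: (boolP (i \in S)) => //= iS.
    by rewrite (subsetP sSV).
  by case: (boolP (i \in V)) => //= iV; rewrite (subsetP VU).
rewrite eU {1}eU' shuffle_signUr; last first.
  rewrite disjoints_subset; apply/subsetP => i; rewrite !inE.
  by move=> /andP[_ ->].
have -> : shuffle_sign R V (U :\: V) =
    shuffle_sign R S (U :\: V) * shuffle_sign R (V :\: S) (U :\: V).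
  by rewrite -shuffle_signUl// SV.
ring.
Qed.

Lemma wedge1l u : wedge (ext_one R N) u = u.
Proof.
apply/ffunP => U; rewrite ffunE (bigD1 set0) ?sub0set//= big1 ?addr0.
  by rewrite ffunE eqxx shuffle_sign0l setD0 !mul1r.
by move=> S /andP[_ /negPf S0]; rewrite ffunE S0 mulr0 mul0r.
Qed.

(** Elements of [ext] may mix degrees, while [ev1] reads only the coefficients at singletons; under
    this condition [ev1] determines the form. *)
Definition covector w := forall S, #|S| != 1%N -> w S = 0.

Lemma covector_dz i : covector (dz R i).
Proof.
by move=> S; rewrite ffunE; case: (eqVneq S [set i]) => [->|//]; rewrite cards1.
Qed.

Lemma covectorD u w : covector u -> covector w -> covector (u + w).
Proof. by move=> hu hw S hS; rewrite ffunE hu// hw// addr0. Qed.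

Lemma covectorZ a w : covector w -> covector (a *: w).
Proof. by move=> hw S hS; rewrite ffunE hw// scaler0. Qed.

Lemma covector_sum n (F : 'I_n -> ext R N) :
  (forall i, covector (F i)) -> covector (\sum_i F i).
Proof.
move=> hF; elim/big_ind: _ => //; last exact: covectorD.
by move=> S _; rewrite ffunE.
Qed.

Lemma covector_wedgeE w u U : covector w ->
  wedge w u U = \sum_(i in U) shuffle_sign R [set i] (U :\ i) * w [set i] * u (U :\ i).
Proof.
move=> hw; rewrite ffunE.
pose F S := shuffle_sign R S (U :\: S) * w S * u (U :\: S).
rewrite -(big_imset F (h := fun i => [set i])) /=; last first.
  by move=> i j _ _; apply: set1_inj.
rewrite (bigID (mem [set [set i] | i in U])) /= [X in _ + X]big1 ?addr0.
  apply: eq_bigl => S; apply/andP/idP => [[]//|h]; split => //.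
  by case/imsetP: h => i iU ->; rewrite sub1set.
move=> S /andP[SU]; case: (boolP (#|S| == 1%N)) => [/cards1P[i Si]|/hw->].
  by rewrite Si imset_f// -sub1set -Si.
by rewrite mulr0 mul0r.
Qed.

Lemma covector_wedge0 w u : covector w -> wedge w u set0 = 0.
Proof. by move=> hw; rewrite covector_wedgeE// big_set0. Qed.

(** Contraction with v as first argument; the sign is that of placing the index i in front of the
    increasing list S. *)
Definition interior_mul v u : ext R N :=
  [ffun S => \sum_(i in ~: S) shuffle_sign R [set i] S * v 0 i * u (i |: S)].

Lemma interior_mul_linear v : linear (interior_mul v).
Proof.
move=> a u w; apply/ffunP => S; rewrite !ffunE.
rewrite scaler_sumr -big_split; apply: eq_bigr => i _ /=.
by rewrite !ffunE mulrDr; congr (_ + _); rewrite /GRing.scale /= mulrCA.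
Qed.

(** Contraction is an antiderivation. Terms where the contracted index is the one carried by w add
    up to [ev1 w v]; in the others the two indices differ and exchanging them changes the sign. *)
Lemma interior_mul_wedge v w u : covector w ->
  interior_mul v (wedge w u) = ev1 w v *: u - wedge w (interior_mul v u).
Proof.
move=> hw; apply/ffunP => S; rewrite ffunE.
have -> : (ev1 w v *: u - wedge w (interior_mul v u)) S =
    ev1 w v * u S - wedge w (interior_mul v u) S.
  by rewrite ffunE [X in X + _]ffunE [X in _ + X]ffunE.
under eq_bigr => i iS.
  rewrite covector_wedgeE// (bigD1 i) ?setU11//= mulrDr setU1K; last first.
    by move: iS; rewrite inE.
  over.
rewrite big_split /=.
have -> : wedge w (interior_mul v u) S = \sum_(j in S) (w [set j] * v 0 j * u S +
   \sum_(i in ~: S) shuffle_sign R [set j] (S :\ j) * shuffle_sign R [set i] (S :\ j)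
      * w [set j] * v 0 i * u (i |: (S :\ j))).
  rewrite covector_wedgeE//; apply: eq_bigr => j jS.
  rewrite ffunE (bigD1 j) /=; last by rewrite !inE eqxx.
  rewrite mulrDr setD1K//; congr (_ + _).
    by rewrite -[RHS]mul1r -(shuffle_sign_sqr [set j] (S :\ j)); ring.
  rewrite mulr_sumr; apply: eq_big => [i|i].
    by rewrite !inE; case: eqVneq => [->|]; rewrite ?jS ?andbF ?andbT.
  by move=> _; ring.
rewrite big_split opprD addrA; congr (_ + _).
  (* Indices outside S come from the left side and indices in S from the right side; together they
     fill the sum defining [ev1 w v]. *)
  apply/eqP; rewrite eq_sym subr_eq; apply/eqP.
  rewrite /ev1 mulr_suml.
  rewrite [LHS](bigID (mem S)) /= [LHS]addrC; congr (_ + _) => //.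
  apply: eq_big => [i|i]; first by rewrite !inE.
  by move=> iS; rewrite -[LHS]mul1r -(shuffle_sign_sqr [set i] S); ring.
rewrite -sumrN.
under [RHS]eq_bigr do rewrite -sumrN.
rewrite [RHS]exchange_big /=; apply: eq_bigr => i; rewrite inE => iS.
rewrite mulr_sumr.
apply: eq_big => [j|j].
  by rewrite !inE; case: eqVneq => [->|]; rewrite ?(negPf iS) ?andbF ?andbT.
rewrite !inE => /andP[/orP[/eqP->|jS]]; rewrite ?eqxx// => ji.
have eS : (i |: S) :\ j = i |: (S :\ j).
  by apply/setP => l; rewrite !inE; case: eqVneq => // ->; rewrite (negPf ji).
have eS1 : shuffle_sign R [set i] S =
   shuffle_sign R [set i] [set j] * shuffle_sign R [set i] (S :\ j).
  rewrite -{1}(setD1K jS) shuffle_signUr//.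
  by rewrite disjoints1 !inE eqxx.
have eS2 : shuffle_sign R [set j] (i |: (S :\ j)) =
   shuffle_sign R [set j] [set i] * shuffle_sign R [set j] (S :\ j).
  by rewrite shuffle_signUr// disjoints1 !inE (negPf iS) andbF.
rewrite eS eS1 eS2 (shuffle_sign1C ji) -[RHS]mul1r.
by rewrite -(shuffle_sign_sqr [set i] [set j]); ring.
Qed.
End Exterior.

(** * Forms evaluated on tuples of vectors, and determinants *)

Section Evaluation.
Variables (R : realType) (N : nat).
Implicit Types (u w : ext R N).

(* [eval_ext v u] is the m-form part of [u] evaluated at (v 0, ..., v m.-1). *)
Fixpoint eval_ext m : ('I_m -> 'rV[R]_N) -> ext R N -> R :=
  match m with
  | 0 => fun _ u => u set0
  | m'.+1 => fun v u => eval_ext (fun j => v (lift ord0 j)) (interior_mul (v ord0) u)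
  end.

Lemma eval_ext_linear m (v : 'I_m -> 'rV[R]_N) :
  linear (eval_ext v : ext R N -> R^o).
Proof.
elim: m v => [|m IH] v a u w /=; first by rewrite !ffunE.
by rewrite interior_mul_linear IH.
Qed.

Lemma eval_ext0 m (v : 'I_m -> 'rV[R]_N) : eval_ext v 0 = 0.
Proof.
by have := eval_ext_linear v (-1) 0 0; rewrite scaler0 addr0 scaleN1r addNr.
Qed.

Lemma eval_extD m (v : 'I_m -> 'rV[R]_N) u w :
  eval_ext v (u + w) = eval_ext v u + eval_ext v w.
Proof. by have := eval_ext_linear v 1 u w; rewrite !scale1r. Qed.

Lemma eval_extZ m (v : 'I_m -> 'rV[R]_N) a u :
  eval_ext v (a *: u) = a * eval_ext v u.
Proof. by rewrite -[a *: u]addr0 eval_ext_linear eval_ext0 addr0. Qed.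

Lemma eval_ext_sum m (v : 'I_m -> 'rV[R]_N) (I : Type) (s : seq I) (P : pred I)
    (F : I -> ext R N) :
  eval_ext v (\sum_(i <- s | P i) F i) = \sum_(i <- s | P i) eval_ext v (F i).
Proof. exact: (big_morph _ (eval_extD v) (eval_ext0 v)). Qed.

Lemma eq_eval_ext m (v v' : 'I_m -> 'rV[R]_N) u :
  v =1 v' -> eval_ext v u = eval_ext v' u.
Proof.
elim: m v v' u => [|m IH] v v' u vv' //=.
by rewrite vv'; apply: IH => j; rewrite vv'.
Qed.

(** Iterating the antiderivation rule: either w absorbs the first vector, or that vector passes it
    at the cost of a sign and the induction continues with the remaining ones. *)
Lemma eval_ext_wedge m (v : 'I_m.+1 -> 'rV[R]_N) w u : covector w ->
  eval_ext v (wedge w u) =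
  \sum_(j < m.+1) (-1) ^+ j * ev1 w (v j) * eval_ext (fun l => v (lift j l)) u.
Proof.
move=> hw; elim: m v u => [|m IH] v u.
  rewrite big_ord1 /= interior_mul_wedge// expr0 mul1r.
  by rewrite ffunE [X in X + _]ffunE [X in _ + X]ffunE covector_wedge0// oppr0 addr0.
rewrite big_ord_recl expr0 mul1r.
rewrite -[LHS]/(eval_ext (fun j => v (lift ord0 j)) (interior_mul (v ord0) (wedge w u))).
rewrite interior_mul_wedge//.
rewrite eval_extD eval_extZ -scaleN1r eval_extZ mulN1r; congr (_ + _).
rewrite IH -sumrN; apply: eq_bigr => j _.
rewrite lift0 exprS mulN1r !mulNr; congr (- (_ * _)).
rewrite -[RHS]/(eval_ext (fun l => v (lift (lift ord0 j) (lift ord0 l)))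
  (interior_mul (v (lift (lift ord0 j) ord0)) u)).
have -> : v (lift (lift ord0 j) ord0) = v ord0.
  by congr v; apply: val_inj; rewrite /= /bump.
apply: eq_eval_ext => l; congr v; apply: val_inj.
by rewrite /= /bump /=; lia.
Qed.

(** Splitting off the first factor with [eval_ext_wedge] is the Laplace expansion of the determinant
    along its first row. *)
Lemma eval_ext_big_wedge m (w : 'I_m -> ext R N) (v : 'I_m -> 'rV[R]_N) :
  (forall i, covector (w i)) ->
  eval_ext v (\big[@wedge R N/ext_one R N]_(i < m) w i) =
  \det (\matrix_(i, j) ev1 (w i) (v j)).
Proof.
elim: m w v => [|m IH] w v hw; first by rewrite big_ord0 det_mx00 /= ffunE eqxx.
rewrite big_ord_recl eval_ext_wedge// (expand_det_row _ ord0).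
apply: eq_bigr => j _; rewrite mxE IH// /cofactor add0n mulrA [ev1 _ _ * _]mulrC.
by congr (_ * \det _); apply/matrixP => a b; rewrite !mxE.
Qed.

Lemma wedge_big_cat (I : Type) (s t : seq I) (w : I -> ext R N) :
  \big[@wedge R N/ext_one R N]_(i <- s ++ t) w i =
  wedge (\big[@wedge R N/ext_one R N]_(i <- s) w i)
        (\big[@wedge R N/ext_one R N]_(i <- t) w i).
Proof.
elim: s => [|i s IH]; first by rewrite big_nil wedge1l.
by rewrite cat_cons !big_cons IH wedgeA.
Qed.

End Evaluation.

(** * The sign of a set of indices followed by its complement *)

Section Sign.
Variable R : realType.

(** Each index precedes all those after it in the list, so no inversion arises and every sign is
    1. *)
Lemma wedge_dz_sorted n (s : seq 'I_n) : sorted ltn (map val s) ->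
  \big[@wedge R n/ext_one R n]_(i <- s) dz R i =
  [ffun S : {set 'I_n} => (S == [set x in s])%:R].
Proof.
elim: s => [_|i s IH] /=.
  by rewrite big_nil; apply/ffunP => S; rewrite !ffunE; congr (_ == _)%:R;
    apply/setP => x; rewrite !inE.
rewrite (path_sortedE ltn_trans) => /andP[/allP his /IH e].
rewrite big_cons e; apply/ffunP => U.
rewrite covector_wedgeE; last exact: covector_dz.
have nis : i \notin s by apply/negP => /(map_f val)/his; rewrite ltnn.
have sgn1 : shuffle_sign R [set i] [set x in s] = 1.
  rewrite /shuffle_sign -[RHS](expr0 (-1)); congr (_ ^+ _).
  apply/eqP; rewrite cards_eq0; apply/eqP/setP => -[a b]; rewrite !inE /=.
  case: eqVneq => //= ->.
  by apply/negP => /andP[/(map_f val)/his /ltnW]; rewrite leqNgt => /negP.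
rewrite ffunE; case: (boolP (U == _)) => [/eqP eU|neU].
  have eUi : U :\ i = [set x in s].
    apply/setP => x; rewrite eU !inE; case: eqVneq => //= ->.
    by rewrite (negPf nis).
  rewrite (bigD1 i) /=; last by rewrite eU !inE eqxx.
  rewrite big1; last first.
    move=> j /andP[_ ji]; rewrite !ffunE (inj_eq set1_inj) (negPf ji).
    by rewrite mulr0 mul0r.
  by rewrite eUi sgn1 !ffunE !eqxx !mul1r addr0.
rewrite big1// => j jU; rewrite !ffunE (inj_eq set1_inj).
case: eqVneq => [ji|]; last by rewrite mulr0 mul0r.
case: eqVneq => [eUj|]; last by rewrite mulr0.
case/eqP: neU; apply/setP => x; move/setP/(_ x): eUj; rewrite -ji !inE.
by case: eqVneq => [->|] //=; rewrite jU.
Qed.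

Lemma sorted_enum_set n (K : {set 'I_n}) : sorted ltn (map val (enum K)).
Proof.
rewrite /enum_mem -enumT; apply: (@subseq_sorted _ ltn ltn_trans _ (iota 0 n)).
  by rewrite -val_enum_ord map_subseq// filter_subseq.
exact: iota_ltn_sorted.
Qed.

Lemma wedge_over_dz n (K : {set 'I_n}) :
  wedge_over K (dz R (N := n)) = [ffun S : {set 'I_n} => (S == K)%:R].
Proof.
rewrite /wedge_over wedge_dz_sorted ?sorted_enum_set//.
by rewrite set_enum.
Qed.

Lemma sum_ltn_ord n (i : 'I_n) : (\sum_(j < n) (j < i)%N = i)%N.
Proof.
rewrite -(big_mkord xpredT (fun j => nat_of_bool (j < i)%N)).
rewrite (big_cat_nat _ (n := i)) ?(ltnW (ltn_ord i))//=.
rewrite [X in (_ + X)%N](eq_big_nat _ _ (F2 := fun=> 0%N)); last first.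
  by move=> j /andP[ij _]; rewrite ltnNge ij.
rewrite [X in (_ + X)%N]big1 ?addn0//.
rewrite (eq_big_nat _ _ (F2 := fun=> 1%N)); last by move=> j /andP[_ ->].
by rewrite sum_nat_const_nat subn0 muln1.
Qed.

(** In fact r(K) equals the number A of inversions between K and its complement. With indices from
    0, an element i of K exceeds exactly i indices; over K, those outside K total A and those inside
    total B. Since 2 B + k = k^2, the subtracted k (k + 1) / 2 is B + k. *)
Lemma shuffle_sign_setC n (K : {set 'I_n}) :
  shuffle_sign R K (~: K) = (-1) ^+ rsign K.
Proof.
rewrite /shuffle_sign; congr (_ ^+ _).
pose B := (\sum_(i in K) \sum_(j in K) (j < i))%N.
(* Pairs below, above and on the diagonal exhaust the square of K, and the first two kinds are
   equally many. *)
have hB : (B + B + #|K| = #|K| * #|K|)%N.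
  rewrite {2}/B exchange_big /= /B -big_split /= -[X in (_ + X)%N]sum1_card -big_split /=.
  rewrite -[X in (X * _)%N]sum1_card big_distrl /=; apply: eq_bigr => i iK.
  rewrite mul1n -sum1_card -big_split /= (bigD1 i)//= [RHS](bigD1 i)//=.
  rewrite !ltnn !add0n addnC; congr (_ + _)%N.
  apply: eq_bigr => j /andP[_]; rewrite -val_eqE /=; lia.
set A := #|_|.
have hA : (\sum_(i in K) i = A + B)%N.
  have -> : A = (\sum_(i in K) \sum_(j in ~: K) (j < i))%N.
    rewrite /A -sum1_card pair_big_dep /= big_mkcond [RHS]big_mkcond /=.
    apply: eq_bigr => -[i j] _; rewrite !inE /=.
    by case: (i \in K) => //=; case: (j \in K) => //=; case: (j < i)%N.
  rewrite /B -big_split /=; apply: eq_bigr => i _.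
  rewrite -{1}(sum_ltn_ord i) (bigID (mem K)) /= addnC; congr (_ + _)%N.
  by apply: eq_bigl => j; rewrite inE.
rewrite /rsign.
have -> : (\sum_(i in K) i.+1 = A + B + #|K|)%N.
  rewrite -hA -sum1_card -big_split /=.
  by apply: eq_bigr => i _; rewrite addn1.
rewrite mulnS -hB.
lia.
Qed.

End Sign.

(** * Sorting the factors of a product over K and its complement *)

Section Sorting.
Variable R : realType.

Lemma eval_ext_perm_wedge N n (t : n.-tuple 'I_n) (s : 'S_n)
    (w : 'I_n -> ext R N) (v : 'I_n -> 'rV[R]_N) :
  (forall i, tnth t i = s i) -> (forall i, covector (w i)) ->
  eval_ext v (\big[@wedge R N/ext_one R N]_(i <- t) w i) =
  (-1) ^+ s * \det (\matrix_(i, j) ev1 (w i) (v j)).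
Proof.
move=> ts hw; rewrite big_tuple eval_ext_big_wedge// -det_perm -det_mulmx -row_permE.
by congr (\det _); apply/matrixP => i j; rewrite !mxE ts.
Qed.

Lemma ev1_dz N (i : 'I_N) (v : 'rV[R]_N) : ev1 (dz R i) v = v 0 i.
Proof.
rewrite /ev1 (bigD1 i)//= ffunE eqxx mul1r big1 ?addr0// => j ji.
by rewrite ffunE (inj_eq set1_inj) (negPf ji) mul0r.
Qed.

(* The standard frame detects the sign of the permutation that sorts K followed
   by its complement, see [eval_ext_wedge_over_setC]. *)
Lemma eval_ext_top n :
  eval_ext (fun j => delta_mx 0 j)
    [ffun S : {set 'I_n} => (S == setT)%:R : R^o] = 1 :> R.
Proof.
have <- : \big[@wedge R n/ext_one R n]_(i < n) dz R i =
    [ffun S : {set 'I_n} => (S == setT)%:R].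
  rewrite [index_enum _]unlock -enumT wedge_dz_sorted; last first.
    by rewrite val_enum_ord iota_ltn_sorted.
  apply/ffunP => S; rewrite !ffunE; congr (_ == _)%:R.
  by apply/setP => x; rewrite !inE mem_enum.
rewrite eval_ext_big_wedge => [|i]; last exact: covector_dz.
rewrite (_ : \matrix_(_, _) _ = 1%:M) ?det1//.
by apply/matrixP => i j; rewrite !mxE ev1_dz mxE eqxx.
Qed.

(** Listing K and then its complement permutes the rows of the determinant. The sign of this
    permutation does not depend on the covectors, so it can be read off from the coordinate ones. *)
Lemma eval_ext_wedge_over_setC N n (K : {set 'I_n}) (w : 'I_n -> ext R N)
    (v : 'I_n -> 'rV[R]_N) : (forall i, covector (w i)) ->
  eval_ext v (wedge (wedge_over K w) (wedge_over (~: K) w)) =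
  (-1) ^+ rsign K * \det (\matrix_(i, j) ev1 (w i) (v j)).
Proof.
have szs : size (enum K ++ enum (~: K)) == n.
  by rewrite size_cat -!cardE cardsC card_ord.
pose t := Tuple szs.
have tinj : injective (tnth t).
  apply/tuple_uniqP; rewrite /= cat_uniq !enum_uniq /= andbT.
  by apply/hasPn => x; rewrite !mem_enum inE.
have tE i : tnth t i = perm tinj i by rewrite permE.
move=> hw; rewrite /wedge_over -wedge_big_cat (eval_ext_perm_wedge (t := t) _ tE)//.
congr (_ * _); rewrite -shuffle_sign_setC.
(* For coordinate covectors on the standard frame the determinant is 1, which isolates the sign of
   the permutation; the same value is then computed as a shuffle sign times the volume form. *)
have := eval_ext_perm_wedge (fun j => delta_mx 0 j) tE (@covector_dz R n).
rewrite (_ : \matrix_(_, _) _ = 1%:M); last first.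
  by apply/matrixP => i j; rewrite !mxE ev1_dz mxE eqxx.
rewrite det1 mulr1 => <-.
rewrite wedge_big_cat -!/(wedge_over _ _) !wedge_over_dz.
rewrite (_ : wedge _ _ = shuffle_sign R K (~: K) *:
    ([ffun S : {set 'I_n} => (S == setT)%:R : R^o] : ext R n)).
  by rewrite eval_extZ eval_ext_top mulr1.
apply/ffunP => U; rewrite !ffunE /GRing.scale /=.
under eq_bigr do rewrite !ffunE.
case: (boolP (K \subset U)) => KU; last first.
  rewrite big1 => [|S SU]; last first.
    case: eqVneq => [SK|]; last by rewrite mulr0 mul0r.
    by rewrite -SK SU in KU.
  by case: eqVneq => [UT|]; rewrite ?mulr0//; rewrite UT subsetT in KU.
rewrite (bigD1 K)//= eqxx mulr1 big1 ?addr0; last first.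
  by move=> S /andP[_ /negPf ->]; rewrite mulr0 mul0r.
case: eqVneq => [UK|UK].
  case: eqVneq => [->|]; first by rewrite setTD.
  case/eqP; apply/setP => x; move/setP/(_ x): UK; rewrite !inE.
  by case: (boolP (x \in K)) => //= /(subsetP KU).
case: eqVneq => [UT|]; last by rewrite !mulr0.
by rewrite UT setTD eqxx in UK.
Qed.

End Sorting.

(** * Adjugates, and averages over subsets of k elements *)

Lemma adj_mx1 (R : comPzRingType) n : \adj (1%:M : 'M[R]_n) = 1%:M.
Proof. by have := mul_mx_adj (1%:M : 'M[R]_n); rewrite mul1mx det1. Qed.

(* T consists of a matrix preceded by an extra column; deleting column j of the
   matrix instead of the extra one replaces, up to sign, column j by the extra
   column. *)
Lemma det_col'_lift (R : comPzRingType) n (T : 'M[R]_(n, n.+1)) (j : 'I_n) :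
  (-1) ^+ (lift ord0 j) * \det (col' (lift ord0 j) T : 'M[R]_n) =
  - \sum_i T i ord0 * \adj (col' ord0 T : 'M[R]_n) j i.
Proof.
case: n T j => [|n] T j; first by case: j.
rewrite (expand_det_col _ ord0) mulr_sumr -sumrN; apply: eq_bigr => i _.
have -> : (col' (lift ord0 j) T : 'M[R]_n.+1) i ord0 = T i ord0.
  by rewrite mxE; congr (T i _); apply: val_inj.
rewrite [\adj _ j i]mxE /cofactor addn0 lift0 exprS mulN1r mulNr exprD.
congr (- _).
have -> : row' i (col' ord0 (col' (lift ord0 j) T : 'M[R]_n.+1)) =
    row' i (col' j (col' ord0 T : 'M[R]_n.+1)).
  apply/matrixP => a b; rewrite !mxE; congr (T _ _); apply: val_inj.
  by rewrite /= /bump /=; lia.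
by ring.
Qed.

(** The k-element sets avoiding i are the k-element subsets of the complement of i; Pascal's rule
    leaves the count of those containing i. *)
Lemma card_draws_mem n k (i : 'I_n) : (0 < k)%N ->
  #|[set K : {set 'I_n} | (#|K| == k) && (i \in K)]%SET| = 'C(n.-1, k.-1).
Proof.
case: n i => [[]//|n] i; case: k => // k _ /=.
pose A := [set K : {set 'I_n.+1} | #|K| == k.+1]%SET.
have eA : #|A| = 'C(n.+1, k.+1).
  rewrite -[in RHS](card_ord n.+1) -cardsT -cards_draws.
  by apply: eq_card => K; rewrite !inE subsetT.
have := cardsID [set K : {set 'I_n.+1} | i \in K]%SET A.
rewrite eA binS.
have -> : #|A :\: [set K : {set 'I_n.+1} | i \in K]|%SET = 'C(n, k.+1).
  transitivity 'C(#|[set~ i]%SET|, k.+1); last by rewrite cardsC1 card_ord.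
  rewrite -cards_draws; apply: eq_card => K.
  by rewrite !inE subsetC sub1set inE andbC.
rewrite addnC => /addnI <-; by apply: eq_card => K; rewrite !inE.
Qed.

(** Each i lies in C(n-1, k-1) of the sets K, and n C(n-1, k-1) = k C(n, k). The factor n / k in
    [Delta] is the one that makes this average the full sum. *)
Lemma sum_draws_mem (R : numFieldType) n k (h : 'I_n -> R) : (1 <= k <= n)%N ->
  \sum_(K : {set 'I_n} | #|K| == k) (n%:R / k%:R) / 'C(n, k)%:R * (\sum_(i in K) h i)
  = \sum_i h i.
Proof.
move=> /andP[k0 kn].
under eq_bigr do rewrite mulr_sumr.
rewrite (exchange_big_dep xpredT)//=; apply: eq_bigr => i _.
rewrite -mulr_suml -[RHS]mul1r; congr (_ * _).
rewrite sumr_const.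
have -> : #|[pred K : {set 'I_n} | (#|K| == k) && (i \in K)]| = 'C(n.-1, k.-1).
  by rewrite -(card_draws_mem i k0); apply: eq_card => K; rewrite !inE.
have n0 : (0 < n)%N by apply: leq_trans kn.
have e : (n * 'C(n.-1, k.-1) = k * 'C(n, k))%N.
  by rewrite -(prednK k0) -(prednK n0) /= mul_bin_diag.
have C0 : 'C(n, k)%:R != 0 :> R by rewrite pnatr_eq0 -lt0n bin_gt0.
have k1 : k%:R != 0 :> R by rewrite pnatr_eq0 -lt0n.
have eR : n%:R * 'C(n.-1, k.-1)%:R = k%:R * 'C(n, k)%:R :> R by rewrite -!natrM e.
rewrite -mulr_natr.
transitivity ((n%:R * 'C(n.-1, k.-1)%:R) / (k%:R * 'C(n, k)%:R) : R).
  by field; rewrite k1 C0.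
by rewrite eR divff// mulf_neq0.
Qed.

From mathcomp Require Import all_classical all_reals all_analysis.
Import numFieldNormedType.Exports.
Local Open Scope classical_set_scope.
Local Open Scope ring_scope.

(** * Differential calculus *)

Section Derivatives.
Variables (R : realType) (V : normedModType R).
Implicit Types (p d : V).

Lemma is_derive_mul (f g : V -> R) p d df dg :
  is_derive p d f df -> is_derive p d g dg ->
  is_derive p d (fun z => f z * g z) (df * g p + f p * dg).
Proof.
move=> hf hg; have h := is_deriveM hf hg.
by apply: (is_derive_eq h); rewrite /GRing.scale /= addrC [g p * _]mulrC.
Qed.

Lemma is_derive_bsum (I : Type) (s : seq I) (P : pred I) (f : I -> V -> R) df p d :
  (forall i, is_derive p d (f i) (df i)) ->
  is_derive p d (fun z => \sum_(i <- s | P i) f i z) (\sum_(i <- s | P i) df i).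
Proof.
move=> hf; elim: s => [|i s IH].
  rewrite big_nil (_ : (fun _ => _) = cst 0); first exact: is_derive_cst.
  by apply/funext => z; rewrite big_nil.
rewrite big_cons; case: ifPn => Pi.
  rewrite (_ : (fun _ => _) = f i + (fun z => \sum_(i <- s | P i) f i z)).
    exact: is_deriveD.
  by apply/funext => z; rewrite big_cons Pi.
by rewrite (_ : (fun _ => _) = (fun z => \sum_(i <- s | P i) f i z))//;
  apply/funext => z; rewrite big_cons (negPf Pi).
Qed.

Lemma derivable_bprod (I : Type) (s : seq I) (P : pred I) (f : I -> V -> R) p d :
  (forall i, derivable (f i) p d) ->
  derivable (fun z => \prod_(i <- s | P i) f i z) p d.
Proof.
move=> hf; elim: s => [|i s IH].
  rewrite (_ : (fun _ => _) = cst 1); first exact: derivable_cst.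
  by apply/funext => z; rewrite big_nil.
case: (boolP (P i)) => Pi.
  rewrite (_ : (fun _ => _) = f i * (fun z => \prod_(i <- s | P i) f i z)).
    exact: derivableM.
  by apply/funext => z; rewrite big_cons Pi.
by rewrite (_ : (fun _ => _) = (fun z => \prod_(i <- s | P i) f i z))//;
  apply/funext => z; rewrite big_cons (negPf Pi).
Qed.

Lemma is_derive_prod_eq1 (I : Type) (s : seq I) (f : I -> V -> R) df p d :
  (forall i, is_derive p d (f i) (df i)) -> (forall i, f i p = 1) ->
  is_derive p d (fun z => \prod_(i <- s) f i z) (\sum_(i <- s) df i).
Proof.
move=> hf f1; elim: s => [|i s IH].
  rewrite big_nil (_ : (fun _ => _) = cst 1); first exact: is_derive_cst.
  by apply/funext => z; rewrite big_nil.
rewrite big_cons (_ : (fun _ => _) = (fun z => f i z * \prod_(i <- s) f i z)).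
  apply: is_derive_eq (is_derive_mul (hf i) IH) _.
  by rewrite f1 mul1r big1 ?mulr1.
by apply/funext => z; rewrite big_cons.
Qed.

(** Every term of the product rule retains at least one of the two vanishing factors. *)
Lemma is_derive_prod_eq0 (I : finType) (i j : I) (f : I -> V -> R) p d :
  (forall i, derivable (f i) p d) -> i != j -> f i p = 0 -> f j p = 0 ->
  is_derive p d (fun z => \prod_i f i z) 0.
Proof.
move=> hf ij fi0 fj0.
rewrite (_ : (fun _ => _) =
    fun z => f i z * (f j z * \prod_(l | (l != i) && (l != j)) f l z)).
  have hr : derivable (fun z => \prod_(l | (l != i) && (l != j)) f l z) p d.
    exact: derivable_bprod.
  apply: is_derive_eq (is_derive_mul (derivableP (hf i))
    (is_derive_mul (derivableP (hf j)) (derivableP hr))) _.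
  by rewrite fi0 fj0 !(mul0r, mulr0) addr0.
by apply/funext => z; rewrite (bigD1 i)//= (bigD1 j)//= eq_sym.
Qed.

Lemma derivable_det n (A : V -> 'M[R]_n) p d :
  (forall i j, derivable (fun z => A z i j) p d) ->
  derivable (fun z => \det (A z)) p d.
Proof.
move=> hA; rewrite /determinant.
suff [] : is_derive p d (fun z => \sum_(s : 'S_n) (-1) ^+ s * \prod_i A z i (s i))
  (\sum_(s : 'S_n) 'D_d (fun z => (-1) ^+ s * \prod_i A z i (s i)) p) by [].
apply: is_derive_bsum => s; apply: derivableP.
apply: (@derivableM _ _ (cst ((-1) ^+ s)) (fun z => \prod_i A z i (s i))).
  exact: derivable_cst.
exact: derivable_bprod.
Qed.

Lemma is_derive_det_add1 n (X : V -> 'M[R]_n) (dX : 'M[R]_n) p d :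
  X p = 0 -> (forall i j, is_derive p d (fun z => X z i j) (dX i j)) ->
  is_derive p d (fun z => \det (1%:M + X z)) (\tr dX).
Proof.
move=> X0 hX.
have hE i j : is_derive p d (fun z => (1%:M + X z) i j) (dX i j).
  rewrite (_ : (fun _ => _) = cst ((1%:M : 'M[R]_n) i j) + (fun z => X z i j)).
    by apply: is_derive_eq; rewrite add0r.
  by apply/funext => z; rewrite mxE.
have Ep i j : (1%:M + X p) i j = (i == j)%:R by rewrite X0 addr0 mxE.
have dE i j : derivable (fun z => (1%:M + X z) i j) p d by case: (hE i j).
(* This is the shape given by the product rule on each signed term of the Leibniz formula; only the
   identity permutation contributes. *)
rewrite (_ : \tr dX =
    \sum_(s : 'S_n) (0 * \prod_i (1%:M + X p) i (s i) +
      (-1) ^+ s * (if s == 1%g then \tr dX else 0))).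
  apply: is_derive_bsum => s; apply: is_derive_mul.
  case: eqVneq => [->|s1].
    apply: is_derive_prod_eq1 => i; first by rewrite perm1; exact: hE.
    by rewrite perm1 Ep eqxx.
  have [i si] : exists i, s i != i.
    apply/existsP; apply: contraR s1; rewrite negb_exists => /forallP h.
    by apply/eqP/permP => i; rewrite perm1; apply/eqP; move: (h i); rewrite negbK.
  (* By injectivity s moves [s i] as well as i, so two off-diagonal factors vanish at p. *)
  apply: (@is_derive_prod_eq0 _ (s i) i) => //.
  - by rewrite Ep eq_sym (inj_eq perm_inj) (negPf si).
  - by rewrite Ep eq_sym (negPf si).
rewrite (bigD1 (1%g : 'S_n))//= [X in _ + X]big1 ?addr0.
  by rewrite mul0r add0r eqxx odd_perm1 mul1r.
by move=> s /negPf ->; rewrite mul0r mulr0 addr0.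
Qed.

(** Differentiate (1 + X) adj(1 + X) = det(1 + X) 1 at p, where 1 + X and its adjugate are both the
    identity: this gives DX + D adj = (tr DX) 1. The entries of the adjugate are signed minors,
    hence derivable to begin with. *)
Lemma is_derive_adj_add1 n (X : V -> 'M[R]_n) (dX : 'M[R]_n) p d i j :
  X p = 0 -> (forall i j, is_derive p d (fun z => X z i j) (dX i j)) ->
  is_derive p d (fun z => (\adj (1%:M + X z)) i j) ((\tr dX)%:M i j - dX i j).
Proof.
move=> X0 hX.
have hE a b : is_derive p d (fun z => (1%:M + X z) a b) (dX a b).
  rewrite (_ : (fun _ => _) = cst ((1%:M : 'M[R]_n) a b) + (fun z => X z a b)).
    by apply: is_derive_eq; rewrite add0r.
  by apply/funext => z; rewrite mxE.
have hadj a b : derivable (fun z => (\adj (1%:M + X z)) a b) p d.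
  rewrite (_ : (fun _ => _) = (fun z => (-1) ^+ (b + a) *
      \det (row' b (col' a (1%:M + X z))))); last by apply/funext => z; rewrite mxE.
  apply: (@derivableM _ _ (cst _)); first exact: derivable_cst.
  apply: derivable_det => k l; rewrite (_ : (fun _ => _) =
      (fun z => (1%:M + X z) (lift b k) (lift a l))).
    by case: (hE (lift b k) (lift a l)).
  by apply/funext => z; rewrite !mxE.
have adjp : \adj (1%:M + X p) = 1%:M by rewrite X0 addr0 adj_mx1.
have /derivableP := hadj i j; set D := 'D_d _ p => hD.
apply: (is_derive_eq hD).
have h1 : is_derive p d (fun z => \sum_k (1%:M + X z) i k * (\adj (1%:M + X z)) k j)
  (\sum_k (dX i k * (\adj (1%:M + X p)) k j + (1%:M + X p) i k *
     'D_d (fun z => (\adj (1%:M + X z)) k j) p)).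
  by apply: is_derive_bsum => k; apply: is_derive_mul => //; apply: derivableP.
have h2 : is_derive p d (fun z => \det (1%:M + X z) * (i == j)%:R)
    (\tr dX * (i == j)%:R + \det (1%:M + X p) * 0).
  by apply: is_derive_mul; exact: is_derive_det_add1.
have e : (fun z => \sum_k (1%:M + X z) i k * (\adj (1%:M + X z)) k j) =
    (fun z => \det (1%:M + X z) * (i == j)%:R).
  apply/funext => z; have /matrixP/(_ i j) := mul_mx_adj (1%:M + X z).
  by rewrite mxE [RHS]mxE => ->; rewrite mulr_natr.
rewrite e in h1; have := @derive_val _ _ _ _ _ _ _ h1.
rewrite (@derive_val _ _ _ _ _ _ _ h2) mulr0 addr0 adjp X0 addr0 big_split /=.
rewrite (bigD1 j)//= [X in _ + X + _]big1 => [|k kj]; last first.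
  by rewrite mxE (negPf kj) mulr0.
rewrite (bigD1 i)//= [X in _ + (_ + X)]big1 => [|k ki]; last first.
  by rewrite mxE eq_sym (negPf ki) mul0r.
have e1 k : (1%:M : 'M[R]_n) k k = 1 by rewrite mxE eqxx.
rewrite !e1 mulr1 mul1r !addr0 -/D => h.
by rewrite [(\tr dX)%:M i j]mxE -mulr_natr h [dX i j + D]addrC addrK.
Qed.

End Derivatives.

(** * Differentiability of forms and the exterior derivative *)

Section FormDerivatives.
Variables (R : realType) (V : normedModType R) (N : nat).
Implicit Types (p d : V) (eta : V -> ext R N).

Lemma differentiable_mul (f g : V -> R) p :
  differentiable f p -> differentiable g p ->
  differentiable (fun z => f z * g z) p.
Proof. exact: differentiableM. Qed.

Lemma differentiable_bsum (I : Type) (s : seq I) (P : pred I) (f : I -> V -> R) p :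
  (forall i, differentiable (f i) p) ->
  differentiable (fun z => \sum_(i <- s | P i) f i z) p.
Proof.
move=> hf; elim: s => [|i s IH].
  rewrite (_ : (fun _ => _) = cst 0); first exact: differentiable_cst.
  by apply/funext => z; rewrite big_nil.
case: (boolP (P i)) => Pi.
  rewrite (_ : (fun _ => _) = f i + (fun z => \sum_(i <- s | P i) f i z)).
    exact: differentiableD.
  by apply/funext => z; rewrite big_cons Pi.
by rewrite (_ : (fun _ => _) = (fun z => \sum_(i <- s | P i) f i z))//;
  apply/funext => z; rewrite big_cons (negPf Pi).
Qed.

Definition form_differentiable eta p :=
  forall S, differentiable (fun z => eta z S : R) p.

Lemma form_differentiable_cst (u : ext R N) p : form_differentiable (fun=> u) p.
Proof. by move=> S; exact: differentiable_cst. Qed.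

Lemma form_differentiableD eta1 eta2 p :
  form_differentiable eta1 p -> form_differentiable eta2 p ->
  form_differentiable (fun z => eta1 z + eta2 z) p.
Proof.
move=> h1 h2 S; rewrite (_ : (fun _ => _) =
  (fun z => eta1 z S : R) + (fun z => eta2 z S : R)); first exact: differentiableD.
by apply/funext => z; rewrite ffunE.
Qed.

Lemma form_differentiableZ (a : V -> R) eta p :
  differentiable a p -> form_differentiable eta p ->
  form_differentiable (fun z => a z *: eta z) p.
Proof.
move=> h1 h2 S; rewrite (_ : (fun _ => _) = (fun z => a z * eta z S)).
  exact: differentiable_mul.
by apply/funext => z; rewrite ffunE.
Qed.

Lemma form_differentiable_bsum (I : Type) (s : seq I) (P : pred I)
    (F : I -> V -> ext R N) p :
  (forall i, P i -> form_differentiable (F i) p) ->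
  form_differentiable (fun z => \sum_(i <- s | P i) F i z) p.
Proof.
move=> hF; elim: s => [|i s IH].
  rewrite (_ : (fun _ => _) = fun=> 0); first exact: form_differentiable_cst.
  by apply/funext => z; rewrite big_nil.
case: (boolP (P i)) => Pi.
  rewrite (_ : (fun _ => _) = (fun z => F i z + \sum_(i <- s | P i) F i z)).
    by apply: form_differentiableD => //; exact: hF.
  by apply/funext => z; rewrite big_cons Pi.
by rewrite (_ : (fun _ => _) = (fun z => \sum_(i <- s | P i) F i z))//;
  apply/funext => z; rewrite big_cons (negPf Pi).
Qed.

Lemma form_differentiable_wedge eta1 eta2 p :
  form_differentiable eta1 p -> form_differentiable eta2 p ->
  form_differentiable (fun z => wedge (eta1 z) (eta2 z)) p.
Proof.
move=> h1 h2 U; rewrite (_ : (fun _ => _) = (fun z =>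
    \sum_(S : {set 'I_N} | S \subset U)
       shuffle_sign R S (U :\: S) * eta1 z S * eta2 z (U :\: S))).
  apply: differentiable_bsum => S; apply: differentiable_mul => //.
  by apply: differentiable_mul => //; exact: differentiable_cst.
by apply/funext => z; rewrite ffunE.
Qed.

Lemma form_differentiable_wedge_over n (K : {set 'I_n}) (w : 'I_n -> V -> ext R N) p :
  (forall i, form_differentiable (w i) p) ->
  form_differentiable (fun z => wedge_over K (fun i => w i z)) p.
Proof.
move=> hw; rewrite /wedge_over; elim: (enum K) => [|i s IH].
  rewrite (_ : (fun _ => _) = fun=> ext_one R N); first exact: form_differentiable_cst.
  by apply/funext => z; rewrite big_nil.
rewrite (_ : (fun _ => _) = (fun z => wedge (w i z)
    (\big[@wedge R N/ext_one R N]_(i <- s) w i z))).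
  exact: form_differentiable_wedge.
by apply/funext => z; rewrite big_cons.
Qed.

Lemma is_derive_eval_ext m (v : 'I_m -> 'rV[R]_N) eta (deta : ext R N) p d :
  (forall S, is_derive p d (fun z => eta z S : R) (deta S)) ->
  is_derive p d (fun z => eval_ext v (eta z)) (eval_ext v deta).
Proof.
elim: m v eta deta => [|m IH] v eta deta h /=; first exact: h.
apply: IH => S; rewrite [interior_mul _ deta S]ffunE.
rewrite (_ : (fun _ => _) = (fun z => \sum_(i in (~: S)%SET)
  shuffle_sign R [set i]%SET S * v ord0 0 i * eta z (i |: S)%SET)).
  apply: (@is_derive_bsum _ _ _ _ _ _ (fun i =>
    shuffle_sign R [set i]%SET S * v ord0 0 i * deta (i |: S)%SET)).
by apply/funext => z; rewrite ffunE.
Qed.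

End FormDerivatives.

Section ExteriorDerivative.
Variables (R : realType).

Lemma derive_sum_coord n (f : 'rV[R]_n -> R) p v : differentiable f p ->
  'D_v f p = \sum_i v 0 i * 'D_(delta_mx 0 i) f p.
Proof.
move=> df; rewrite deriveE// {1}(row_sum_delta v) linear_sum /=.
by apply: eq_bigr => i _; rewrite linearZ /= deriveE.
Qed.

(** The arguments are constant vector fields, so no bracket terms appear. Expanding each dz^i
    against [u j] and summing over i assembles the partial derivatives into the derivative along
    [u j]. *)
Lemma eval_extd N m (u : 'I_m.+1 -> 'rV[R]_N) (eta : 'rV[R]_N -> ext R N) p :
  form_differentiable eta p ->
  eval_ext u (extd eta p) = \sum_(j < m.+1) (-1) ^+ j *
    'D_(u j) (fun z => eval_ext (fun l => u (lift j l)) (eta z)) p.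
Proof.
move=> heta; rewrite eval_ext_sum.
under eq_bigr => i _ do rewrite (eval_ext_wedge _ _ (@covector_dz _ _ i)).
rewrite exchange_big; apply: eq_bigr => j _ /=.
have h : is_derive p (u j) (fun z => eval_ext (fun l => u (lift j l)) (eta z))
    (eval_ext (fun l => u (lift j l)) [ffun S => 'D_(u j) (fun z => eta z S : R) p]).
  apply: is_derive_eval_ext => S; rewrite ffunE.
  by apply: derivableP; exact: diff_derivable.
rewrite (@derive_val _ _ _ _ _ _ _ h).
under eq_bigr do rewrite ev1_dz -mulrA -eval_extZ.
rewrite -mulr_sumr -eval_ext_sum; congr (_ * eval_ext _ _).
apply/ffunP => S; rewrite sum_ffunE ffunE derive_sum_coord//.
by apply: eq_bigr => i _; rewrite !ffunE.
Qed.

End ExteriorDerivative.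

(** * Symmetry of second derivatives *)

Section Schwarz.
Variables (R : realType) (V : normedModType R).
Implicit Types (p q a b : V) (f : V -> R).

Lemma is_derive_line f q a (r : R) df :
  is_derive (q + r *: a) a f df -> is_derive r 1 (fun r => f (q + r *: a)) df.
Proof.
have e : (fun h : R => h^-1 *: (f (q + (h *: 1 + r) *: a) - f (q + r *: a))) =
    (fun h : R => h^-1 *: (f (h *: a + (q + r *: a)) - f (q + r *: a))).
  apply/funext => h; congr (_ *: (f _ - _)).
  by rewrite scalerDl addrCA [h *: 1]mulr1.
by move=> [h1 h2]; split; rewrite ?/derivable ?/derive /= e.
Qed.

(* The mean value theorem, applied in direction a and then in direction b. *)
Lemma second_difference f fa fab p a b (s : R) : 0 < s ->
  (forall r t, 0 <= r <= s -> 0 <= t <= s ->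
     is_derive (p + r *: a + t *: b) a f (fa (p + r *: a + t *: b)) /\
     is_derive (p + r *: a + t *: b) b fa (fab (p + r *: a + t *: b))) ->
  exists r t, [/\ 0 <= r <= s, 0 <= t <= s &
    f (p + s *: a + s *: b) - f (p + s *: a) - (f (p + s *: b) - f p) =
    fab (p + r *: a + t *: b) * s * s].
Proof.
move=> s0 h.
have ss : 0 <= s <= s by rewrite lexx ltW.
have zs : 0 <= (0 : R) <= s by rewrite lexx ltW.
have hF r t : 0 <= r <= s -> 0 <= t <= s ->
    is_derive r 1 (fun r => f (p + r *: a + t *: b)) (fa (p + r *: a + t *: b)).
  move=> hr ht; rewrite (_ : (fun _ => _) = fun r => f (p + t *: b + r *: a)).
    by apply: is_derive_line; rewrite addrAC; case: (h r t hr ht).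
  by apply/funext => x; rewrite addrAC.
have sub (x : R) : x \in `]0, s[ -> 0 <= x <= s.
  by rewrite in_itv /= => /andP[? ?]; rewrite !ltW.
pose F r := f (p + r *: a + s *: b) - f (p + r *: a + 0 *: b).
have dF r : 0 <= r <= s ->
    is_derive r 1 F (fa (p + r *: a + s *: b) - fa (p + r *: a + 0 *: b)).
  by move=> hr; apply: is_deriveB; exact: hF.
have [|r rs eF] := @MVT R F _ 0 s s0 (fun r hr => dF r (sub r hr)).
  apply: derivable_within_continuous => x; rewrite in_itv /= => hx.
  by case: (dF x hx).
have hG t : 0 <= t <= s -> is_derive t 1 (fun t => fa (p + r *: a + t *: b))
    (fab (p + r *: a + t *: b)).
  by move=> ht; apply: is_derive_line; case: (h r t (sub _ rs) ht).
have [|t ts eG] := @MVT R (fun t => fa (p + r *: a + t *: b)) _ 0 s s0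
  (fun t ht => hG t (sub t ht)).
  apply: derivable_within_continuous => x; rewrite in_itv /= => hx.
  by case: (hG x hx).
exists r, t; split; [exact: sub|exact: sub|].
by move: eF; rewrite eG /F !scale0r !addr0 subr0 => <-.
Qed.

(** Both orders of differentiation express the same second difference, through values at two points
    of a small parallelogram at p; by continuity at p these values are arbitrarily close to [fab p]
    and [fba p]. *)
Lemma is_derive_swap (O : set V) f fa fb fab fba p a b :
  open O -> O p ->
  (forall z, O z -> is_derive z a f (fa z)) ->
  (forall z, O z -> is_derive z b f (fb z)) ->
  (forall z, O z -> is_derive z b fa (fab z)) ->
  (forall z, O z -> is_derive z a fb (fba z)) ->
  {for p, continuous fab} -> {for p, continuous fba} -> fab p = fba p.
Proof.
move=> Oo Op ha hb hab hba cab cba; apply/eqP; rewrite -subr_eq0 -normr_le0.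
apply/ler_addgt0Pr => e e0; rewrite add0r.
have e2 : 0 < e / 2 by rewrite divr_gt0.
have : \forall z \near p, [/\ O z, `|fab p - fab z| < e / 2 & `|fba p - fba z| < e / 2].
  near=> z; split; near: z; first exact: open_nbhs_nbhs.
    by move/cvgr_dist_lt: cab; apply.
  by move/cvgr_dist_lt: cba; apply.
move=> /nbhs_normP[/= d d0 hd].
(* The added 1 keeps M positive when a and b vanish; with s = d / (2 M) the whole parallelogram
   stays within d / 2 of p. *)
pose M := `|a| + `|b| + 1.
have M0 : 0 < M by rewrite /M ltr_wpDl// addr_ge0.
pose s := d / (2 * M).
have s0 : 0 < s by rewrite /s divr_gt0// mulr_gt0.
have inO a' b' r t : `|a'| + `|b'| + 1 = M -> 0 <= r <= s -> 0 <= t <= s ->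
    `|p - (p + r *: a' + t *: b')| < d.
  move=> eM /andP[r0 rs] /andP[t0 ts].
  rewrite -addrA opprD addrA subrr add0r normrN.
  apply: le_lt_trans (ler_normD _ _) _; rewrite !normrZ !ger0_norm//.
  apply: (@le_lt_trans _ _ (s * M)).
    rewrite -eM; have := normr_ge0 a'; have := normr_ge0 b'; nra.
  have -> : s * M = d / 2 by rewrite /s; field; rewrite gt_eqF.
  by rewrite ltr_pdivrMr// ltr_pMr// ltr1n.
have eM : `|b| + `|a| + 1 = M by rewrite /M [`|b| + _]addrC.
have [|r [t [hr ht e1]]] := @second_difference f fa fab p a b s s0.
  move=> r t hr ht; have [Oz _ _] := hd _ (inO a b r t erefl hr ht).
  by split; [exact: ha|exact: hab].
have [|r' [t' [hr' ht' e1']]] := @second_difference f fb fba p b a s s0.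
  move=> r' t' hr' ht'; have [Oz _ _] := hd _ (inO b a r' t' eM hr' ht').
  by split; [exact: hb|exact: hba].
have [_ d1 _] := hd _ (inO a b r t erefl hr ht).
have [_ _ d2] := hd _ (inO b a r' t' eM hr' ht').
have ee : fab (p + r *: a + t *: b) = fba (p + r' *: b + t' *: a).
  have sn : s != 0 by rewrite gt_eqF.
  apply: (mulIf sn); apply: (mulIf sn); rewrite -e1 -e1'.
  by rewrite [p + s *: b + s *: a]addrAC; ring.
rewrite -(subrKA (fab (p + r *: a + t *: b))) {2}ee.
apply: le_trans (ler_normD _ _) _; rewrite [e]splitr; apply: lerD; first exact: ltW.
by rewrite distrC ltW.
Unshelve. all: by end_near.
Qed.

End Schwarz.

(** * Evaluation of Delta on frames *)

Section Ev1.
Variables (R : realType) (N : nat).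
Implicit Types (w : ext R N) (v : 'rV[R]_N).

Lemma ev1D w w' v : ev1 (w + w') v = ev1 w v + ev1 w' v.
Proof.
by rewrite /ev1 -big_split; apply: eq_bigr => i _ /=; rewrite ffunE mulrDl.
Qed.

Lemma ev1Z a w v : ev1 (a *: w) v = a * ev1 w v.
Proof. by rewrite /ev1 mulr_sumr; apply: eq_bigr => i _; rewrite ffunE -mulrA. Qed.

Lemma ev1_sum n (F : 'I_n -> ext R N) v : ev1 (\sum_i F i) v = \sum_i ev1 (F i) v.
Proof.
apply: (big_morph (fun w => ev1 w v)) => [w w'|]; first exact: ev1D.
by rewrite /ev1 big1// => i _; rewrite ffunE mul0r.
Qed.

End Ev1.

Section Slope.
Variables (R : realType) (n nu k : nat).
Variables (f : jet_space R n nu -> R) (g : 'rV[R]_(n + nu) -> 'M[R]_(nu, n)).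
Implicit Types (p q v : 'rV[R]_(n + nu)) (K : {set 'I_n}).

Lemma ev1_omega al q v : ev1 (omega g al q) v =
  v 0 (rshift n al) - \sum_j g q al j * v 0 (lshift nu j).
Proof.
rewrite /omega -scaleN1r ev1D ev1Z mulN1r ev1_sum ev1_dz; congr (_ - _).
by apply: eq_bigr => j _; rewrite ev1Z ev1_dz.
Qed.

Lemma covector_omega al q : covector (omega g al q).
Proof.
rewrite /omega -scaleN1r; apply: covectorD; first exact: covector_dz.
apply: covectorZ; apply: covector_sum => j; apply: covectorZ.
exact: covector_dz.
Qed.

Definition slope_vec p (l : 'I_n) : 'rV[R]_(n + nu) :=
  row_mx (delta_mx 0 l) (\row_al g p al l).

(** The vector is frozen at p while the form is taken at q. The difference, zero at q = p, is the
    source of the perturbation X. *)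
Lemma ev1_omega_slope_vec al p q l :
  ev1 (omega g al q) (slope_vec p l) = g p al l - g q al l.
Proof.
rewrite ev1_omega row_mxEr mxE (bigD1 l)//= row_mxEl mxE !eqxx mulr1 big1 ?addr0//.
by move=> j /negPf jl; rewrite row_mxEl mxE jl andbF mulr0.
Qed.

Lemma ev1_omega_fibre al be q :
  ev1 (omega g al q) (delta_mx 0 (rshift n be)) = (al == be)%:R.
Proof.
rewrite ev1_omega mxE eqxx (inj_eq (@rshift_inj _ _)) big1 ?subr0// => j _.
by rewrite mxE eq_lrshift andbF mulr0.
Qed.

(* The i-th factor of Delta evaluated at v, divided by [fhat] when i is in K. *)
Definition theta_dir K q (i : 'I_n) v : R := v 0 (lshift nu i) +
  (i \in K)%:R * (n%:R / k%:R / fhat f g q) *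
    \sum_al phat f g i al q * ev1 (omega g al q) v.

(** Taking [fhat] out of the rows in K yields its k-th power, of which one factor survives the
    division by the power k - 1; the sign r(K) meets the equal sign coming from sorting, and their
    product is 1. *)
Lemma eval_Delta (v : 'I_n -> 'rV[R]_(n + nu)) q : (1 <= k)%N -> fhat f g q != 0 ->
  eval_ext v (Delta k f g q) = \sum_(K : {set 'I_n} | #|K| == k)
    fhat f g q / 'C(n, k)%:R * \det (\matrix_(i, l) theta_dir K q i (v l)).
Proof.
move=> k0 f0; rewrite eval_ext_sum; apply: eq_bigr => K /eqP cK.
rewrite eval_extZ; set th := fun i => _ + _.
(* A single family serves both products, so that their product is one determinant. *)
pose w i := if i \in K then th i else dt R nu i.
have -> : wedge_over K th = wedge_over K w.
  by apply: eq_big_seq => i; rewrite mem_enum /w => ->.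
have -> : wedge_over (~: K)%SET (dt R nu (n := n)) = wedge_over (~: K)%SET w.
  by apply: eq_big_seq => i; rewrite mem_enum inE /w => /negPf ->.
have hw i : covector (w i).
  rewrite /w; case: ifP => _; last exact: covector_dz.
  apply: covectorD; apply: covectorZ; first exact: covector_dz.
  by apply: covector_sum => al; apply: covectorZ; exact: covector_omega.
rewrite eval_ext_wedge_over_setC//.
pose d : 'rV[R]_n := \row_i (if i \in K then fhat f g q else 1).
have -> : \matrix_(i, l) ev1 (w i) (v l) =
    diag_mx d *m \matrix_(i, l) theta_dir K q i (v l).
  apply/matrixP => i l; rewrite mul_diag_mx !mxE /theta_dir /w.
  case: (i \in K); last by rewrite ev1_dz mul0r mul0r addr0 mul1r.
  rewrite ev1D !ev1Z ev1_dz ev1_sum; under eq_bigr do rewrite ev1Z.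
  set S := \sum_al _; rewrite /=.
  by field; rewrite f0 pnatr_eq0 -lt0n k0.
rewrite det_mulmx det_diag.
have -> : \prod_i d 0 i = fhat f g q ^+ k.
  rewrite -cK -prodr_const [RHS]big_mkcond /=.
  by apply: eq_bigr => i _; rewrite mxE.
have -> : fhat f g q ^+ k = fhat f g q * fhat f g q ^+ k.-1.
  by rewrite -exprS prednK.
set s : R := (-1) ^+ _; have ss : s * s = 1 by rewrite /s -expr2 sqrr_sign.
set D := \det _; set F := fhat f g q in f0 *.
have Fk : F ^+ k.-1 != 0 by rewrite expf_neq0.
transitivity ((s * s) * (F ^+ k.-1 / F ^+ k.-1) * (F / 'C(n, k)%:R * D)).
  by rewrite invfM; ring.
by rewrite ss divff// !mul1r.
Qed.

(** The matrix X for the set K: the vectors are frozen at p and the forms are read at q. Its rows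
    outside K are zero. *)
Definition slope_perturb K p q : 'M[R]_n :=
  \matrix_(i, l) ((i \in K)%:R * (n%:R / k%:R / fhat f g q) *
    \sum_al phat f g i al q * (g p al l - g q al l)).

Lemma eval_Delta_slope p q : (1 <= k)%N -> fhat f g q != 0 ->
  eval_ext (slope_vec p) (Delta k f g q) = \sum_(K : {set 'I_n} | #|K| == k)
    fhat f g q / 'C(n, k)%:R * \det (1%:M + slope_perturb K p q).
Proof.
move=> k0 f0; rewrite eval_Delta//; apply: eq_bigr => K _.
congr (_ * \det _); apply/matrixP => i l; rewrite !mxE /theta_dir row_mxEl mxE eqxx.
congr (_ + _ * _); apply: eq_bigr => al _.
by rewrite ev1_omega_slope_vec.
Qed.

Definition frame p (be : 'I_nu) (j : 'I_n.+1) : 'rV[R]_(n + nu) :=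
  if unlift ord0 j is Some i then slope_vec p i else delta_mx 0 (rshift n be).

(** Omitting the j-th leaf direction leaves the fibre vector among the arguments. By [det_col'_lift]
    its column is paired with row j of the adjugate, and the 1 / [fhat] in that column cancels the
    prefactor. *)
Lemma eval_Delta_frame p q be (j : 'I_n) : (1 <= k)%N -> fhat f g q != 0 ->
  (-1) ^+ (lift ord0 j) *
  eval_ext (fun l => frame p be (lift (lift ord0 j) l)) (Delta k f g q) =
  - \sum_(K : {set 'I_n} | #|K| == k) (n%:R / k%:R) / 'C(n, k)%:R *
    \sum_(i in K) phat f g i be q * \adj (1%:M + slope_perturb K p q) j i.
Proof.
move=> k0 f0; rewrite eval_Delta// mulr_sumr -sumrN; apply: eq_bigr => K _.
pose T : 'M[R]_(n, n.+1) := \matrix_(i, l) theta_dir K q i (frame p be l).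
have -> : \matrix_(i, l) theta_dir K q i (frame p be (lift (lift ord0 j) l)) =
    col' (lift ord0 j) T by apply/matrixP => a b; rewrite !mxE.
rewrite mulrCA (det_col'_lift T j).
have -> : (col' ord0 T : 'M[R]_n) = 1%:M + slope_perturb K p q.
  apply/matrixP => i l; rewrite !mxE /frame liftK /theta_dir row_mxEl mxE eqxx.
  congr (_ + _ * _); apply: eq_bigr => al _.
  by rewrite ev1_omega_slope_vec.
rewrite mulrN; congr (- _); rewrite !mulr_sumr [RHS]big_mkcond /=.
(* Entry i of the fibre column: dt^i vanishes on d/dx^be and omega^al gives a Kronecker symbol, so
   only p^i_be remains for i in K, and nothing for other i. *)
apply: eq_bigr => i _; rewrite mxE /frame unlift_none /theta_dir.
rewrite mxE eq_lrshift andbF add0r.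
rewrite (bigD1 be)//= ev1_omega_fibre eqxx mulr1 big1 ?addr0; last first.
  by move=> al /negPf ab; rewrite ev1_omega_fibre ab mulr0.
case: (i \in K); last by rewrite !mul0r mulr0.
set A := \adj _ _ _; set F := fhat f g q in f0 *.
transitivity ((F / F) * (n%:R / k%:R / 'C(n, k)%:R * (phat f g i be q * A))).
  by rewrite /=; ring.
by rewrite divff// mul1r.
Qed.

End Slope.

(** * The differential identity expressed by closedness of Delta *)

Section Lagrangian.
Variables (R : realType) (n nu k : nat).
Variables (Om : set 'rV[R]_(n + nu)) (f : jet_space R n nu -> R).
Variable g : 'rV[R]_(n + nu) -> 'M[R]_(nu, n).
Hypothesis hk : (1 <= k <= n)%N.
Hypothesis Om_open : open Om.
Hypothesis f_smooth : smooth_on [set z : jet_space R n nu | Om z.1] f.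
Hypothesis g_smooth : smooth_on Om g.
Hypothesis fhat_neq0 : forall p, Om p -> fhat f g p != 0.
Implicit Types (p q d : 'rV[R]_(n + nu)) (K : {set 'I_n}).

Lemma differentiable_slope p : Om p -> differentiable g p.
Proof. by move=> Op; have [h _] := g_smooth 1; exact: h. Qed.

Lemma differentiable_slope_coord p al i : Om p ->
  differentiable (fun q => g q al i) p.
Proof.
move=> Op; apply: (@differentiable_comp _ _ _ _ g (fun M : 'M[R]_(nu, n) => M al i : R)).
  exact: differentiable_slope.
exact: differentiable_coord.
Qed.

Lemma differentiable_section p : Om p -> differentiable (fun q => (q, g q)) p.
Proof.
move=> Op; apply: differentiable_pair; first exact: ex_diff.
exact: differentiable_slope.
Qed.

Lemma differentiable_fhat p : Om p -> differentiable (fhat f g) p.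
Proof.
move=> Op; apply: (@differentiable_comp _ _ _ _ (fun q => (q, g q)) f).
  exact: differentiable_section.
by have [h _] := f_smooth 1; exact: h.
Qed.

Lemma differentiable_phat p i al : Om p -> differentiable (phat f g i al) p.
Proof.
move=> Op; apply: (@differentiable_comp _ _ _ _ (fun q => (q, g q)) (f_q f al i)).
  exact: differentiable_section.
have [_ /(_ (0, delta_mx al i)) [h _]] := f_smooth 2; exact: h.
Qed.

Lemma form_differentiable_omega p al : Om p ->
  form_differentiable (fun q => omega g al q) p.
Proof.
move=> Op; rewrite /omega.
rewrite (_ : (fun _ => _) =
  fun q => dx R n al + (fun=> -1) q *: \sum_(j < n) g q al j *: dt R nu j).
  apply: form_differentiableD; first exact: form_differentiable_cst.
  apply: form_differentiableZ; first exact: differentiable_cst.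
  apply: form_differentiable_bsum => j _.
  apply: form_differentiableZ; first exact: differentiable_slope_coord.
  exact: form_differentiable_cst.
by apply/funext => q; rewrite scaleN1r.
Qed.

Lemma form_differentiable_Delta p : Om p ->
  form_differentiable (Delta k f g) p.
Proof.
move=> Op; apply: form_differentiable_bsum => K _.
apply: (@form_differentiableZ _ _ _
    (fun q => (-1) ^+ rsign K / ('C(n, k)%:R * fhat f g q ^+ k.-1))).
  apply: differentiable_mul; first exact: differentiable_cst.
  apply: differentiableV.
    apply: differentiable_mul; first exact: differentiable_cst.
    case: k.-1 => [|m]; first exact: differentiable_cst.
    rewrite (_ : (fun _ => _) = fhat f g ^+ m.+1); last first.
      by apply/funext => q; rewrite exprfctE.
    by apply: differentiableX; exact: differentiable_fhat.
  rewrite mulf_neq0// ?expf_neq0 ?fhat_neq0// pnatr_eq0 -lt0n bin_gt0.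
  by case/andP: hk.
apply: form_differentiable_wedge; last exact: form_differentiable_cst.
apply: form_differentiable_wedge_over => i; apply: form_differentiableD.
  apply: (@form_differentiableZ _ _ _ (fhat f g)); first exact: differentiable_fhat.
  exact: form_differentiable_cst.
apply: (@form_differentiableZ _ _ _ (fun=> n%:R / k%:R)); first exact: differentiable_cst.
apply: form_differentiable_bsum => al _.
apply: (@form_differentiableZ _ _ _ (phat f g i al)); first exact: differentiable_phat.
exact: form_differentiable_omega.
Qed.

(** The derivative of X at p. The factors [g p al l - g q al l] vanish at q = p, so only their own
    derivatives survive, with a minus sign because the moving point is in the subtracted term. *)
Definition dslope_perturb K p d : 'M[R]_n :=
  \matrix_(i, l) - ((i \in K)%:R * (n%:R / k%:R / fhat f g p) *
    \sum_al phat f g i al p * 'D_d (fun q => g q al l) p).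

Lemma is_derive_slope_perturb K p d i l : Om p ->
  is_derive p d (fun q => slope_perturb k f g K p q i l) (dslope_perturb K p d i l).
Proof.
move=> Op; rewrite (_ : (fun _ => _) = fun q =>
  (i \in K)%:R * (n%:R / k%:R / fhat f g q) *
    \sum_al phat f g i al q * (g p al l - g q al l)); last first.
  by apply/funext => q; rewrite mxE.
have h1 : derivable (fun q => (i \in K)%:R * (n%:R / k%:R / fhat f g q)) p d.
  apply: diff_derivable; apply: differentiable_mul; first exact: differentiable_cst.
  apply: differentiable_mul; first exact: differentiable_cst.
  by apply: differentiableV; [exact: differentiable_fhat|exact: fhat_neq0].
have h2 : is_derive p d (fun q => \sum_al phat f g i al q * (g p al l - g q al l))
   (\sum_al ('D_d (phat f g i al) p * (g p al l - g p al l) +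
      phat f g i al p * - 'D_d (fun q => g q al l) p)).
  apply: is_derive_bsum => al; apply: is_derive_mul.
    by apply: derivableP; apply: diff_derivable; exact: differentiable_phat.
  have h := derivableP (@diff_derivable _ _ _ _ _ d (differentiable_slope_coord al l Op)).
  have h' := is_deriveB (is_derive_cst (g p al l) p d) h.
  by rewrite sub0r in h'; exact: h'.
apply: is_derive_eq (is_derive_mul (derivableP h1) h2) _.
rewrite [X in _ * X + _]big1 ?mulr0 ?add0r; last by move=> al _; rewrite subrr mulr0.
rewrite mxE -mulrN -sumrN; congr (_ * _); apply: eq_bigr => al _.
by rewrite subrr mulr0 add0r mulrN.
Qed.

Lemma slope_perturb_self K p : slope_perturb k f g K p p = 0.
Proof.
apply/matrixP => i l; rewrite !mxE big1 ?mulr0// => al _.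
by rewrite subrr mulr0.
Qed.

Hypothesis M_lagrangian : k_lagrangian k Om f g.

(** Closedness is tested on the fibre vector followed by the leaf directions; the term
    differentiated along the fibre stays on the left and the others move to the right. *)
Lemma lagrangian_frame p be : Om p ->
  'D_(delta_mx 0 (rshift n be)) (fun q => \sum_(K : {set 'I_n} | #|K| == k)
    fhat f g q / 'C(n, k)%:R * \det (1%:M + slope_perturb k f g K p q)) p =
  \sum_j 'D_(slope_vec g p j) (fun q => \sum_(K : {set 'I_n} | #|K| == k)
    (n%:R / k%:R) / 'C(n, k)%:R * \sum_(i in K)
      phat f g i be q * (\adj (1%:M + slope_perturb k f g K p q)) j i) p.
Proof.
move=> Op; have k0 : (1 <= k)%N by case/andP: hk.
have := eval_extd (frame g p be) (form_differentiable_Delta Op).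
rewrite (M_lagrangian Op) eval_ext0 big_ord_recl expr0 mul1r => /esym/eqP.
have nearOm : \forall q \near p, Om q by exact: open_nbhs_nbhs.
have -> : 'D_(frame g p be ord0) (fun z => eval_ext
    (fun l => frame g p be (lift ord0 l)) (Delta k f g z)) p =
  'D_(delta_mx 0 (rshift n be)) (fun q => \sum_(K : {set 'I_n} | #|K| == k)
    fhat f g q / 'C(n, k)%:R * \det (1%:M + slope_perturb k f g K p q)) p.
  have -> : frame g p be ord0 = delta_mx 0 (rshift n be) by rewrite /frame unlift_none.
  (* The determinant formula needs [fhat] nonzero, hence holds on the open set [Om]; agreement near
     p suffices for the derivatives. *)
  apply: near_eq_derive; near=> q.
  rewrite -eval_Delta_slope//; last by apply: fhat_neq0; near: q.
  by apply: eq_eval_ext => l; rewrite /frame liftK.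
rewrite addr_eq0 => /eqP ->; rewrite -sumrN; apply: eq_bigr => j _.
have -> : frame g p be (lift ord0 j) = slope_vec g p j by rewrite /frame liftK.
have dE : derivable (fun z => eval_ext (fun l => frame g p be (lift (lift ord0 j) l))
    (Delta k f g z)) p (slope_vec g p j).
  have [] // := @is_derive_eval_ext _ _ _ _ (fun l => frame g p be (lift (lift ord0 j) l))
    (Delta k f g) [ffun S => 'D_(slope_vec g p j) (fun z => Delta k f g z S : R) p]
    p (slope_vec g p j).
  move=> S; rewrite ffunE; apply: derivableP; apply: diff_derivable.
  exact: form_differentiable_Delta.
(* The constant sign goes inside the derivative, to match [eval_Delta_frame]. *)
rewrite -deriveMl// -deriveN; last first.
  by apply: derivableM => //; exact: derivable_cst.
apply: near_eq_derive; near=> q.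
rewrite -[RHS]opprK -eval_Delta_frame//.
by apply: fhat_neq0; near: q.
Unshelve. all: by end_near. Qed.

Lemma lagrangian_pde p be : Om p ->
  (forall al j l, 'D_(slope_vec g p j) (fun q => g q al l) p =
                  'D_(slope_vec g p l) (fun q => g q al j) p) ->
  'D_(delta_mx 0 (rshift n be)) (fhat f g) p - \sum_i \sum_al
     phat f g i al p * 'D_(delta_mx 0 (rshift n be)) (fun q => g q al i) p =
  \sum_j 'D_(slope_vec g p j) (phat f g j be) p.
Proof.
move=> Op sym; have kn : (k <= n)%N by case/andP: hk.
have := lagrangian_frame be Op.
set u0 : 'rV[R]_(n + nu) := delta_mx 0 _.
have C0 : 'C(n, k)%:R != 0 :> R by rewrite pnatr_eq0 -lt0n bin_gt0.
have F0 := fhat_neq0 Op.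
have dX K d := fun i l => is_derive_slope_perturb K d i l Op.
have X0 K := slope_perturb_self K p.
have dfh d : is_derive p d (fun q => fhat f g q / 'C(n, k)%:R)
    ('D_d (fhat f g) p / 'C(n, k)%:R).
  have hf := derivableP (diff_derivable (v := d) (differentiable_fhat Op)).
  apply: is_derive_eq (is_derive_mul hf (is_derive_cst ('C(n, k)%:R^-1 : R) p d)) _.
  by rewrite mulr0 addr0.
have h1 : is_derive p u0 (fun q => \sum_(K : {set 'I_n} | #|K| == k)
    fhat f g q / 'C(n, k)%:R * \det (1%:M + slope_perturb k f g K p q))
    (\sum_(K : {set 'I_n} | #|K| == k)
      ('D_u0 (fhat f g) p / 'C(n, k)%:R * \det (1%:M + slope_perturb k f g K p p) +
      fhat f g p / 'C(n, k)%:R * \tr (dslope_perturb K p u0))).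
  apply: is_derive_bsum => K; apply: is_derive_mul; exact: is_derive_det_add1.
rewrite (@derive_val _ _ _ _ _ _ _ h1) big_split /=.
(* The determinant is 1 at p, and the C(n, k) equal summands undo the division. *)
have -> : \sum_(K : {set 'I_n} | #|K| == k) 'D_u0 (fhat f g) p / 'C(n, k)%:R *
    \det (1%:M + slope_perturb k f g K p p) = 'D_u0 (fhat f g) p.
  under eq_bigr do rewrite X0 addr0 det1 mulr1.
  rewrite sumr_const -[X in _ *+ X]/(#|[pred K : {set 'I_n} | #|K| == k]|).
  have -> : #|[pred K : {set 'I_n} | #|K| == k]| = 'C(n, k).
    rewrite -[in RHS](card_ord n) -cardsT -cards_draws.
    by apply: eq_card => K; rewrite !inE finset.subsetT.
  by rewrite -[LHS]mulr_natr divfK.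
(* The prefactor cancels the 1 / [fhat] in the trace, and averaging over K gives the full sum over
   i. *)
have -> : \sum_(K : {set 'I_n} | #|K| == k) fhat f g p / 'C(n, k)%:R *
      \tr (dslope_perturb K p u0) =
    - \sum_i \sum_al phat f g i al p * 'D_u0 (fun q => g q al i) p.
  rewrite -(sum_draws_mem _ hk) -sumrN; apply: eq_bigr => K _.
  rewrite /mxtrace mulr_sumr mulr_sumr -sumrN [RHS]big_mkcond /=.
  apply: eq_bigr => i _; rewrite mxE; case: (i \in K); last by rewrite !mul0r oppr0 mulr0.
  set s := \sum_al _; set F := fhat f g p in F0 *.
  transitivity (- ((F / F) * (n%:R / k%:R / 'C(n, k)%:R * s))); first by rewrite /=; ring.
  by rewrite divff// mul1r.
move=> ->.
have hP d i : is_derive p d (phat f g i be) ('D_d (phat f g i be) p).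
  by apply: derivableP; apply: diff_derivable; exact: differentiable_phat.
have h2 j : is_derive p (slope_vec g p j) (fun q => \sum_(K : {set 'I_n} | #|K| == k)
    (n%:R / k%:R) / 'C(n, k)%:R * \sum_(i in K)
      phat f g i be q * (\adj (1%:M + slope_perturb k f g K p q)) j i)
   (\sum_(K : {set 'I_n} | #|K| == k) (0 * (\sum_(i in K)
      phat f g i be p * (\adj (1%:M + slope_perturb k f g K p p)) j i) +
      (n%:R / k%:R) / 'C(n, k)%:R * \sum_(i in K)
     ('D_(slope_vec g p j) (phat f g i be) p *
        (\adj (1%:M + slope_perturb k f g K p p)) j i +
      phat f g i be p * ((\tr (dslope_perturb K p (slope_vec g p j)))%:M j i -
         dslope_perturb K p (slope_vec g p j) j i)))).
  apply: is_derive_bsum => K; apply: is_derive_mul; apply: is_derive_bsum => i.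
  by apply: is_derive_mul; apply: is_derive_adj_add1.
under eq_bigr => j _ do rewrite (@derive_val _ _ _ _ _ _ _ (h2 j)).
(* The right side is spread over the sets K in turn, which leaves one identity for each K and each i
   in K. *)
rewrite exchange_big /= -(sum_draws_mem _ hk); apply: eq_bigr => K _.
under eq_bigr do rewrite mul0r add0r.
rewrite -mulr_sumr; congr (_ * _); rewrite exchange_big /=; apply: eq_bigr => i iK.
rewrite X0 addr0 adj_mx1 big_split /=.
have -> : \sum_(j < n) 'D_(slope_vec g p j) (phat f g i be) p * (1%:M : 'M[R]_n) j i =
    'D_(slope_vec g p i) (phat f g i be) p.
  rewrite (bigD1 i)//= big1 => [|j ji]; last by rewrite mxE (negPf ji) mulr0.
  by rewrite mxE eqxx mulr1 addr0.
(* The quadratic remainder is p^i_be times tr DX(v_i) minus the sum over j of the entries (j, i) of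
   DX(v_j). Its j-th terms contain D_(v_i) g^al_j and D_(v_j) g^al_i, which are equal by [sym]. *)
rewrite -[RHS]addr0; congr (_ + _); rewrite -mulr_sumr sumrB.
have -> : \sum_(j < n) (\tr (dslope_perturb K p (slope_vec g p j)))%:M j i =
    \tr (dslope_perturb K p (slope_vec g p i)).
  rewrite (bigD1 i)//= big1 => [|j ji]; last by rewrite mxE (negPf ji).
  by rewrite mxE eqxx mulr1n addr0.
rewrite /mxtrace -sumrB big1 ?mulr0// => j _.
rewrite /dslope_perturb [X in X - _]mxE [X in _ - X]mxE.
by under eq_bigr do rewrite sym; rewrite subrr.
Qed.

End Lagrangian.

Section MatrixDerivative.
Variables (R : realType) (V : normedModType R).

Lemma derive_entry m n (M : V -> 'M[R]_(m, n)) t v i j : derivable M t v ->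
  'D_v (fun z => M z i j) t = ('D_v M t) i j.
Proof. by move=> hM; rewrite derive_mx// mxE. Qed.

Lemma is_derive_entry m n (M : V -> 'M[R]_(m, n)) t v i j : derivable M t v ->
  is_derive t v (fun z => M z i j) (('D_v M t) i j).
Proof.
move=> hM; split; last exact: derive_entry.
by have /derivable_mxP := hM; exact.
Qed.

End MatrixDerivative.

(** * The chain rule for the integrand along the slope field *)

Section FibreDerivative.
Variables (R : realType) (n nu : nat).
Variables (Om : set 'rV[R]_(n + nu)) (f : jet_space R n nu -> R).
Variable g : 'rV[R]_(n + nu) -> 'M[R]_(nu, n).
Hypothesis f_smooth : smooth_on [set z : jet_space R n nu | Om z.1] f.
Hypothesis g_smooth : smooth_on Om g.

Lemma derive_fhat_fibre p be : Om p ->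
  'D_(delta_mx 0 (rshift n be)) (fhat f g) p = f_x f be (p, g p) +
  \sum_i \sum_al phat f g i al p * 'D_(delta_mx 0 (rshift n be)) (fun q => g q al i) p.
Proof.
move=> Op; set u0 : 'rV[R]_(n + nu) := delta_mx 0 _.
have df : differentiable f (p, g p) by have [h _] := f_smooth 1; exact: h.
have dg := differentiable_slope g_smooth Op.
have ds := differentiable_section g_smooth Op.
rewrite deriveE; last exact: (differentiable_fhat f_smooth g_smooth).
rewrite (_ : fhat f g = f \o (fun q => (q, g q)))// diff_comp//=.
have -> : 'd (fun q => (q, g q)) p u0 = (u0, 'D_u0 g p).
  by rewrite diff_pair// deriveE// diff_val.
rewrite exchange_big /=.
(* The direction is split into its pure x-part and coordinate q-directions, on which the
   differential of f gives [f_x] and the momenta [phat]. *)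
have -> : (u0, 'D_u0 g p) = (u0, 0) + \sum_al \sum_i
    ('D_u0 g p al i) *: ((0, delta_mx al i) : jet_space R n nu).
  rewrite {1}(matrix_sum_delta ('D_u0 g p)).
  have pD (A B : 'M[R]_(nu, n)) :
    ((0, A + B) : jet_space R n nu) = (0, A) + (0, B).
    by apply: injective_projections; rewrite /= ?addr0.
  have -> (A : 'M[R]_(nu, n)) : ((u0, A) : jet_space R n nu) = (u0, 0) + (0, A).
    by apply: injective_projections; rewrite /= ?addr0 ?add0r.
  congr (_ + _); rewrite (big_morph _ pD (erefl _)); apply: eq_bigr => al _.
  rewrite (big_morph _ pD (erefl _)); apply: eq_bigr => i _.
  by apply: injective_projections; rewrite /= ?scaler0.
rewrite linearD /=; congr (_ + _); first by rewrite /f_x [RHS]deriveE.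
rewrite linear_sum; apply: eq_bigr => al _.
rewrite linear_sum; apply: eq_bigr => i _.
rewrite linearZ /= mulrC -derive_entry; last exact: diff_derivable.
by congr (_ * _); rewrite /phat /f_q deriveE.
Qed.

End FibreDerivative.

(** * Leaves *)

Section Leaf.
Variables (R : realType) (n nu : nat).
Variables (Om : set 'rV[R]_(n + nu)) (g : 'rV[R]_(n + nu) -> 'M[R]_(nu, n)).
Hypothesis g_smooth : smooth_on Om g.
Variables (V : set 'rV[R]_n) (x : 'rV[R]_n -> 'rV[R]_nu).
Hypothesis x_leaf : leaf_graph Om g V x.
Let phi (t : 'rV[R]_n) : 'rV[R]_(n + nu) := row_mx t (x t).

(** The tangent vector lies in the distribution. Its t-part is the i-th unit vector because the leaf
    is a graph over t, and the equations omega^al = 0 then determine its x-part. *)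
Lemma leaf_tangent s i : V s -> 'D_(delta_mx 0 i) phi s = slope_vec g (phi s) i.
Proof.
move=> Vs; have [oV sm h] := x_leaf.
have dphi : differentiable phi s by have [d _] := sm 1; exact: d.
have [_ rg] := h _ Vs.
set v : 'rV[R]_n := delta_mx 0 i; set w := 'D_v phi s.
have wl j : w 0 (lshift nu j) = v 0 j.
  rewrite /w -derive_entry; last exact: diff_derivable.
  rewrite (_ : (fun _ => _) = fun z : 'rV[R]_n => z 0 j); last first.
    by apply/funext => z; rewrite row_mxEl.
  by rewrite (@derive_entry _ _ _ _ id)// derive_id.
have : slope_distribution g (phi s) w.
  by rewrite -rg; exists v => //; rewrite /w deriveE.
move=> hw; apply/rowP => j; rewrite /slope_vec -/v.
case: (split_ordP j) => a ->; first by rewrite row_mxEl wl.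
have := hw a; rewrite ev1_omega => /eqP; rewrite subr_eq0 => /eqP ->.
rewrite row_mxEr mxE (bigD1 i)//= wl /v mxE !eqxx mulr1 big1 ?addr0// => l li.
by rewrite wl /v mxE (negPf li) andbF mulr0.
Qed.

Lemma derive_leaf_comp (h : 'rV[R]_(n + nu) -> R) s i : V s ->
  differentiable h (phi s) ->
  'D_(slope_vec g (phi s) i) h (phi s) = 'D_(delta_mx 0 i) (h \o phi) s.
Proof.
move=> Vs dh; have [_ sm _] := x_leaf.
have dphi : differentiable phi s by have [d _] := sm 1; exact: d.
rewrite -leaf_tangent// !deriveE//; last exact: differentiable_comp.
by rewrite (@diff_comp _ _ _ _ phi h).
Qed.

Lemma slope_symmetric t al j l : V t ->
  'D_(slope_vec g (phi t) j) (fun q => g q al l) (phi t) =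
  'D_(slope_vec g (phi t) l) (fun q => g q al j) (phi t).
Proof.
move=> Vt; have [oV sm h] := x_leaf.
have Op : Om (phi t) by case: (h _ Vt).
have [d0 /[dup] hl hj] := sm 2.
have {hl}[d1l cl] := hl (delta_mx 0 l).
have {hj}[d1j cj] := hj (delta_mx 0 j).
(* Both sides become mixed second derivatives of x^al; the identification of the slope with a first
   derivative holds on all of the open set V, so it may be differentiated at t. *)
have e a b : 'D_(slope_vec g (phi t) a) (fun q => g q al b) (phi t) =
    ('D_(delta_mx 0 a) ('D_(delta_mx 0 b) phi) t) 0 (rshift n al).
  rewrite derive_leaf_comp//; last exact: (differentiable_slope_coord g_smooth).
  have [_ /(_ (delta_mx 0 b)) [d1 _]] := sm 2.
  rewrite -derive_entry; last by apply: diff_derivable; exact: d1.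
  apply: near_eq_derive; near=> s.
  have Vs : V s by near: s; exact: open_nbhs_nbhs.
  by rewrite leaf_tangent//= row_mxEr mxE.
rewrite !e.
have cc (F : 'rV[R]_n -> 'rV[R]_(n + nu)) i : {for t, continuous F} ->
    {for t, continuous (fun s => F s 0 i)}.
  move=> cF; apply: (@continuous_comp _ _ _ F (fun M => M 0 i)) => //.
  exact: coord_continuous.
apply: (@is_derive_swap _ _ V (fun s => phi s 0 (rshift n al))
  (fun s => ('D_(delta_mx 0 l) phi s) 0 (rshift n al))
  (fun s => ('D_(delta_mx 0 j) phi s) 0 (rshift n al))
  (fun s => ('D_(delta_mx 0 j) ('D_(delta_mx 0 l) phi) s) 0 (rshift n al))
  (fun s => ('D_(delta_mx 0 l) ('D_(delta_mx 0 j) phi) s) 0 (rshift n al))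
  t (delta_mx 0 l) (delta_mx 0 j)) => //.
- by move=> z Vz; apply: is_derive_entry; apply: diff_derivable; exact: d0.
- by move=> z Vz; apply: is_derive_entry; apply: diff_derivable; exact: d0.
- by move=> z Vz; apply: is_derive_entry; apply: diff_derivable; exact: d1l.
- by move=> z Vz; apply: is_derive_entry; apply: diff_derivable; exact: d1j.
- by apply: cc; exact: cl.
- by apply: cc; exact: cj.
Unshelve. all: by end_near. Qed.

Lemma jet1_leaf s : V s -> jet1 x s = (phi s, g (phi s)).
Proof.
move=> Vs; rewrite /jet1 -/(phi s); congr (_, _); apply/matrixP => al i.
have [_ sm _] := x_leaf.
have dphi : differentiable phi s by have [d _] := sm 1; exact: d.
rewrite mxE (_ : (fun _ => _) = fun z => phi z 0 (rshift n al)); last first.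
  by apply/funext => z; rewrite row_mxEr.
rewrite derive_entry; last exact: diff_derivable.
by rewrite leaf_tangent// row_mxEr mxE.
Qed.

End Leaf.

(** * The Euler equations along the leaves *)

Theorem theorem3 (R : realType) (n nu k : nat)
    (Om : set 'rV[R]_(n + nu))
    (f : jet_space R n nu -> R)
    (g : 'rV[R]_(n + nu) -> 'M[R]_(nu, n))
    (hk : (1 <= k <= n)%N)
    (Om_open : open Om)
    (f_smooth : smooth_on [set z : jet_space R n nu | Om z.1] f)
    (g_smooth : smooth_on Om g)
    (fhat_neq0 : forall p, Om p -> fhat f g p != 0)
    (g_integrable : integrable_distribution Om g)
    (M_lagrangian : k_lagrangian k Om f g) :
  forall (V : set 'rV[R]_n) (x : 'rV[R]_n -> 'rV[R]_nu),
    leaf_graph Om g V x -> euler_equations f V x.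
Proof.
move=> V x x_leaf t Vt al; have [oV sm h] := x_leaf.
have [Op _] := h _ Vt.
have pde := lagrangian_pde hk Om_open f_smooth g_smooth fhat_neq0 M_lagrangian al Op
  (fun be j l => slope_symmetric g_smooth x_leaf be j l Vt).
rewrite (jet1_leaf x_leaf Vt).
(* The chain rule contributes exactly the subtracted terms in the derivatives of g, so the left side
   reduces to [f_x]. *)
rewrite (derive_fhat_fibre f_smooth g_smooth al Op) addrK in pde.
rewrite pde; apply/eqP; rewrite subr_eq0; apply/eqP; apply: eq_bigr => i _.
(* The derivative of [phat] along a leaf direction is the total derivative d/dt^i of f_q along the
   leaf, since there the 1-jet of x lies on the section q = g(t, x). *)
rewrite (derive_leaf_comp x_leaf)//; last exact: (differentiable_phat f_smooth g_smooth).
apply: near_eq_derive; near=> s.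
have Vs : V s by near: s; exact: open_nbhs_nbhs.
by rewrite (jet1_leaf x_leaf Vs).
Unshelve. all: by end_near. Qed.
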